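(* Let $p$ be a prime number and let a group $K$ act on a group $H$ by automorphisms. Then: (1) $\gamma_*^{[p]}(H\rtimes K)=\gamma_*^K(H)^{[p]}\rtimes\gamma_*^{[p]}(K)$ (termwise); (2) if $K$ acts trivially on $H^{\mathrm{ab}}\otimes\mathbb F_p$, then $\gamma_*^K(H)^{[p]}=\gamma_*^{[p]}(H)$. In particular, if $K$ acts trivially on $H^{\mathrm{ab}}\otimes\mathbb F_p$, then there is a canonical isomorphism of graded $p$-restricted Lie rings $\mathrm{gr}_*^{[p]}(H\rtimes K)\cong\mathrm{gr}_*^{[p]}(H)\rtimes\mathrm{gr}_*^{[p]}(K)$.
   Context: Commutators are $[a,b]=aba^{-1}b^{-1}$; $[A,B]$ is the subgroup generated by the $[a,b]$; $A^p$ is the subgroup generated by the $a^p$, $a\in A$. A filtration $G_*$ on a group $G$ is a sequence of subgroups $G=G_1\supseteq G_2\supseteq\cdots$. It is an $N$-series if $[G_i,G_j]\subseteq G_{i+j}$ for all $i,j\ge1$; an $N_p$-series is an $N$-series such that $G_i^p\subseteq G_{pi}$ for all $i\ge1$. For an $N$-series $G_*$, $\mathrm{gr}(G_* )=\bigoplus_{i\ge1}G_i/G_{i+1}$ is a graded Lie ring with bracket induced by commutators; if $G_*$ is an $N_p$-series, then $\mathrm{gr}(G_* )$ together with the maps $\mathrm{gr}_i\to\mathrm{gr}_{pi}$ induced by $g\mapsto g^p$ is a graded $p$-restricted Lie algebra over $\mathbb F_p$ (Lazard). For an $N$-series $G_*$, $G_*^{[p]}$ denotes the smallest $N_p$-series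 on $G_1$ containing $G_*$ (it exists). The $p$-restricted lower central series $\gamma_*^{[p]}(G)$ is the smallest $N_p$-series on $G$, and $\mathrm{gr}_*^{[p]}(G)=\mathrm{gr}(\gamma_*^{[p]}(G))$. If $K$ acts on $H$, the $N$-series $\gamma_*^K(H)$ on $H$ is given by $\gamma_1^K(H)=H$, $\gamma_{n+1}^K(H)=[H\rtimes K,\gamma_n^K(H)]$ (in $H\rtimes K$). If $K_*$ and $H_*$ are $N_p$-series and $[K_j,H_i]\subseteq H_{i+j}$ in $H\rtimes K$ for all $i,j\ge1$, then $\mathrm{gr}(K_* )$ acts on $\mathrm{gr}(H_* )$ by ($p$-restricted) derivations via $\bar k\cdot\bar h=\overline{(k\cdot h)h^{-1}}$, and $\mathrm{gr}(H_* )\rtimes\mathrm{gr}(K_* )$ is the direct sum with bracket $[(h,k),(h',k')]=([h,h']+k\cdot h'-k'\cdot h,[k,k'])$, with the $p$-restricted structure that restricts to those of $\mathrm{gr}(H_* )$ and $\mathrm{gr}(K_* )$ (it is determined on sums by Jacobson's formula for $(x+y)^{[p]}$). This applies to $H_*=\gamma_*^{[p]}(H)$, $K_*=\gamma_*^{[p]}(K)$ in the last statement. *)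

(* Defs.v *)
(* Groups are arbitrary, possibly infinite, [groupType]s; their subgroups are
   sets in the sense of classical_sets. *)
From HB Require Import structures.
From mathcomp Require Import all_boot all_order all_algebra.
From mathcomp Require Import boolp classical_sets.

Set Implicit Arguments.
Unset Strict Implicit.
Unset Printing Implicit Defensive.

Import GRing.Theory.

Local Open Scope classical_set_scope.
Local Open Scope group_scope.

Section Series.
Variable G : groupType.
Implicit Types (A B X : set G) (S T : nat -> set G).

(* The convention is a b a^-1 b^-1, whereas [~ a, b] is a^-1 b^-1 a b. *)
Definition comm (a b : G) : G := a * b * a^-1 * b^-1.

Record is_subgroup A : Prop := IsSubgroup {
  sg1 : A 1;
  sgM : forall x y, A x -> A y -> A (x * y);
  sgV : forall x, A x -> A x^-1 }.

Definition gen X : set G := smallest is_subgroup X.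

Definition commsub A B : set G :=
  gen [set z | exists a b, [/\ A a, B b & z = comm a b]].

Definition powsub (p : nat) A : set G := gen [set a ^+ p | a in A].

(* A filtration is indexed by i >= 1. The index 0 carries no information: it
   is only normalised to the whole group, so that the 0-th graded piece is 0. *)
Record is_filtration S : Prop := IsFiltration {
  filt0 : S 0%N = setT;
  filt1 : S 1%N = setT;
  filt_sg : forall i, is_subgroup (S i);
  filt_desc : forall i, S i.+1 `<=` S i }.

Definition is_Nseries S : Prop :=
  is_filtration S /\
  forall i j, 0 < i -> 0 < j -> commsub (S i) (S j) `<=` S (i + j)%N.

Definition is_Npseries (p : nat) S : Prop :=
  is_Nseries S /\ forall i, 0 < i -> powsub p (S i) `<=` S (p * i)%N.

Definition Np_closure (p : nat) S (n : nat) : set G :=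
  \bigcap_(T in [set T | is_Npseries p T /\ forall i, 0 < i -> S i `<=` T i]) T n.

Definition gammap_set (p : nat) (n : nat) : set G :=
  \bigcap_(T in [set T | is_Npseries p T]) T n.

Lemma gen_sub X : X `<=` gen X.
Proof. by move=> x Xx A [_]; apply. Qed.

Lemma gen_min X A : is_subgroup A -> X `<=` A -> gen X `<=` A.
Proof. by move=> sA XA x; apply. Qed.

Lemma genP X : is_subgroup (gen X).
Proof.
split=> [A [[]]|x y gx gy A AX|x gx A AX] //.
  by have [[_ sM _] _] := AX; apply: sM; [apply: gx|apply: gy].
by have [[_ _ sV] _] := AX; apply: sV; apply: gx.
Qed.

Lemma gen_mono X Y : X `<=` Y -> gen X `<=` gen Y.
Proof. by move=> XY; apply: gen_min (genP _) _ => x /XY; apply: gen_sub. Qed.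

Lemma is_subgroup_bigcap I (F : I -> set G) (P : set I) :
  (forall i, P i -> is_subgroup (F i)) -> is_subgroup (\bigcap_(i in P) F i).
Proof.
move=> sF; split=> [i Pi|x y Fx Fy i Pi|x Fx i Pi].
- exact: sg1 (sF i Pi).
- by apply: (sgM (sF i Pi)); [apply: Fx|apply: Fy].
- by apply: (sgV (sF i Pi)); apply: Fx.
Qed.

Lemma bigcap_Npseries (p : nat) (F : set (nat -> set G)) :
  (forall S, F S -> is_Npseries p S) ->
  is_Npseries p (fun n => \bigcap_(S in F) S n).
Proof.
move=> FN; split; first split; first split.
- apply/seteqP; split=> // x _ S /FN NS.
  by case: NS => [[[S0 _ _ _] _] _]; rewrite S0.
- apply/seteqP; split=> // x _ S /FN NS.
  by case: NS => [[[_ S1 _ _] _] _]; rewrite S1.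
- by move=> i; apply: is_subgroup_bigcap => S /FN[[[_ _ sS _] _] _]; apply: sS.
- by move=> i x Fx S FS; have [[[_ _ _ dS] _] _] := FN S FS; apply: dS; apply: Fx.
- move=> i j i0 j0 x cx S FS; have [[_ cS] _] := FN S FS.
  apply: (cS i j i0 j0); apply: gen_mono cx => _ [a [b [Fa Fb ->]]].
  by exists a, b; split=> //; [apply: Fa|apply: Fb].
- move=> i i0 x px S FS; have [_ pS] := FN S FS.
  apply: (pS i i0); apply: gen_mono px => _ [a Fa <-].
  by exists a => //; apply: Fa.
Qed.

Lemma Np_closureP (p : nat) S : is_Npseries p (Np_closure p S).
Proof. by apply: bigcap_Npseries => T []. Qed.

Lemma gammap_setP (p : nat) : is_Npseries p (gammap_set p).
Proof. exact: bigcap_Npseries. Qed.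

End Series.

Record npSeries (p : nat) (G : groupType) := NpSeries {
  series :> nat -> set G;
  npseriesP : is_Npseries p series }.

Definition gammap (p : nat) (G : groupType) : npSeries p G :=
  NpSeries (@gammap_setP G p).

Record abpair (G : groupType) := AbPair {
  top : set G;
  bot : set G;
  topP : is_subgroup top;
  botP : is_subgroup bot;
  bot_top : bot `<=` top;
  bot_comm : forall a b, top a -> top b -> bot (comm a b) }.

Section AbQuot.
Variables (G : groupType) (P : abpair G).
Local Notation A := (top P).
Local Notation N := (bot P).

Definition abrel (x y : set_type A) : bool := `[< N (val x / val y) >].

Lemma top_val (x : set_type A) : A (val x).
Proof. exact: set_mem (valP x). Qed.

Lemma bot_conj a n : A a -> N n -> N (a * n * a^-1).
Proof.
move=> Aa Nn.
have -> : a * n * a^-1 = comm a n * n by rewrite /comm mulgVK.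
by apply: (sgM (botP P)) => //; apply: bot_comm => //; apply: bot_top.
Qed.

Lemma abrel_refl : reflexive abrel.
Proof. by move=> x; apply/asboolP; rewrite mulgV; apply: sg1 (botP P). Qed.

Lemma abrel_sym : symmetric abrel.
Proof.
suff s x y : abrel x y -> abrel y x by move=> x y; apply/idP/idP; apply: s.
by move=> /asboolP/(sgV (botP P)); rewrite invgF => ?; apply/asboolP.
Qed.

Lemma abrel_trans : transitive abrel.
Proof.
move=> y x z /asboolP xy /asboolP yz; apply/asboolP.
by have := sgM (botP P) xy yz; rewrite mulgA mulgVK.
Qed.

Canonical abrel_equiv := EquivRel abrel abrel_refl abrel_sym abrel_trans.

Definition abquot : Type := {eq_quot abrel}%qT.
HB.instance Definition _ := Choice.on abquot.

(* The class in A / N of an element of A; elements outside A are sent to 0. *)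
Definition cls (x : G) : abquot :=
  (\pi_({eq_quot abrel}) (insubd (SigSub (mem_set (sg1 (topP P)))) x))%qT.

Definition rep (q : abquot) : G := val (repr (q : {eq_quot abrel}%qT)).

Lemma rep_top q : A (rep q). Proof. exact: top_val. Qed.

Lemma clsP x y : A x -> A y -> cls x = cls y <-> N (x / y).
Proof.
move=> Ax Ay; have vE z : A z ->
    val (insubd (SigSub (mem_set (sg1 (topP P)))) z) = z.
  by move=> Az; rewrite insubdK //; apply: mem_set.
by split=> [/eqmodP/asboolP|Nxy]; last (apply/eqmodP/asboolP);
  rewrite !vE.
Qed.

Lemma repK : cancel rep cls.
Proof.
move=> q; rewrite /cls /rep valKd; exact: reprK.
Qed.

Definition abadd q r := cls (rep q * rep r).
Definition abopp q := cls (rep q)^-1.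

Lemma rep_cls x : A x -> N (rep (cls x) / x).
Proof. by move=> Ax; apply/clsP; rewrite ?repK //; apply: rep_top. Qed.

Lemma abaddE x y : A x -> A y -> abadd (cls x) (cls y) = cls (x * y).
Proof.
move=> Ax Ay; have [X Y] := (rep_cls Ax, rep_cls Ay).
have [AX AY] := (rep_top (cls x), rep_top (cls y)).
apply/clsP; try by apply: (sgM (topP P)).
set X' := rep (cls x) in X AX *; set Y' := rep (cls y) in Y AY *.
have -> : X' * Y' / (x * y) = X' * (Y' / y) * X'^-1 * (X' / x).
  by rewrite invgM !mulgA mulgVK.
by apply: (sgM (botP P)) => //; apply: bot_conj.
Qed.

Lemma aboppE x : A x -> abopp (cls x) = cls x^-1.
Proof.
move=> Ax; have X := rep_cls Ax; have AX := rep_top (cls x).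
apply/clsP; try by apply: (sgV (topP P)).
have -> : (rep (cls x))^-1 / x^-1
        = x^-1 * (x * (rep (cls x))^-1) * x^-1^-1.
  by rewrite mulgA mulVg mul1g.
apply: bot_conj; first by apply: (sgV (topP P)).
by rewrite -invgF; apply: (sgV (botP P)).
Qed.

Let A1 := sg1 (topP P).
Let AM := sgM (topP P).
Let AV := sgV (topP P).

Lemma abaddA : associative abadd.
Proof.
move=> q r s; rewrite -(repK q) -(repK r) -(repK s).
by do ![rewrite abaddE; try by do ?apply: AM; apply: rep_top]; rewrite mulgA.
Qed.

Lemma abaddC : commutative abadd.
Proof.
move=> q r; apply/clsP; try by apply: AM; apply: rep_top.
by rewrite invgM mulgA; apply: bot_comm; apply: rep_top.
Qed.

Lemma abadd0 : left_id (cls 1) abadd.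
Proof. by move=> q; rewrite -(repK q) abaddE ?mul1g //; apply: rep_top. Qed.

Lemma abaddN : left_inverse (cls 1) abopp abadd.
Proof.
move=> q; rewrite -(repK q) aboppE ?abaddE ?mulVg //; last exact: rep_top.
- by apply: AV; apply: rep_top.
- exact: rep_top.
Qed.

HB.instance Definition _ :=
  GRing.isZmodule.Build abquot abaddA abaddC abadd0 abaddN.

Lemma cls1 : cls 1 = 0%R. Proof. by []. Qed.

Lemma clsM x y : A x -> A y -> cls (x * y) = (cls x + cls y)%R.
Proof. by move=> Ax Ay; rewrite -abaddE. Qed.

End AbQuot.

Arguments cls {G} P x.
Arguments rep {G P} q.

(* H^ab (x) F_p, modelled as H / [H,H] H^p; [modab_univ] below is the         *)
(* universal property of the tensor product for this model: biadditive maps   *)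
(* out of H^ab x F_p are the maps out of H x F_p additive in each argument.   *)

Section ModAb.
Variables (p : nat) (H : groupType).

Definition modab_bot : set H :=
  gen ([set z | exists a b, z = comm a b] `|` [set a ^+ p | a in setT]).

Lemma setT_subgroup : is_subgroup [set: H]. Proof. by []. Qed.

Lemma modab_comm (a b : H) : setT a -> setT b -> modab_bot (comm a b).
Proof. by move=> _ _; apply: gen_sub; left; exists a, b. Qed.

Definition modab_pair : abpair H :=
  AbPair setT_subgroup (genP _) (@subsetT _ _) modab_comm.

Definition modab : zmodType := abquot modab_pair.

Definition modab_tens (h : H) (c : 'F_p) : modab := (cls modab_pair h *+ c)%R.

Definition biadditive (V : zmodType) (beta : H -> 'F_p -> V) : Prop :=
  (forall c, {morph beta^~ c : h h' / (h * h')%g >-> (h + h')%R}) /\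
  (forall h, {morph beta h : c d / (c + d)%R}).

Lemma modab_pow h : (cls modab_pair h *+ p)%R = 0%R.
Proof.
have E n : (cls modab_pair h *+ n)%R = cls modab_pair (h ^+ n).
  by elim: n => [|n IHn] //; rewrite mulrS IHn expgS clsM.
rewrite E -(cls1 modab_pair); apply/clsP => //.
by rewrite invg1 mulg1; apply: gen_sub; right; exists h.
Qed.

Lemma modab_tens_biadditive : prime p -> biadditive modab_tens.
Proof.
move=> pr; split=> [c h h'|h c d]; rewrite /modab_tens.
  by rewrite clsM // mulrnDl.
rewrite -mulrnDr [in RHS](divn_eq (c + d) p) mulrnDr mulnC mulrnA modab_pow.
rewrite mul0rn add0r /=; congr (_ *+ (_ %% _))%R; exact: Fp_cast.
Qed.

Lemma modab_univ (V : zmodType) (beta : H -> 'F_p -> V) :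
  prime p -> biadditive beta ->
  exists f : modab -> V,
    [/\ {morph f : x y / (x + y)%R},
        forall h c, f (modab_tens h c) = beta h c &
        forall g : modab -> V, {morph g : x y / (x + y)%R} ->
          (forall h c, g (modab_tens h c) = beta h c) -> g =1 f].
Proof.
move=> pr [bM bD]; pose b h := beta h 1%R.
have morph0 (W : zmodType) (g : W -> V) : {morph g : x y / (x + y)%R} -> g 0%R = 0%R.
  by move=> gD; apply: (addrI (g 0%R)); rewrite -gD !addr0.
have bM1 h h' : b (h * h') = (b h + b h')%R by apply: bM.
have b1 : b 1 = 0%R by apply: (addrI (b 1)); rewrite -bM1 mulg1 addr0.
have bV h : b h^-1 = (- b h)%R.
  by apply/eqP; rewrite -addr_eq0 -bM1 mulVg b1.
have bX h n : b (h ^+ n) = (b h *+ n)%R.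
  by elim: n => [|n IHn] //; rewrite expgS bM1 IHn mulrS.
have bn h n : beta h (n%:R)%R = (b h *+ n)%R.
  elim: n => [|n IHn]; first exact: morph0 (bD h).
  by rewrite -natr1 bD IHn mulrSr.
have kerP : modab_bot `<=` [set h | b h = 0%R].
  apply: gen_min; first split=> //=.
  - by move=> x y bx by_; rewrite bM1 bx by_ addr0.
  - by move=> x bx; rewrite bV bx oppr0.
  move=> _ [[x [y ->]]|[x _ <-]] /=.
    by rewrite /comm !bM1 !bV addrAC addrK subrr.
  by rewrite bX -bn pchar_Fp_0 // morph0.
have brep h : b (rep (cls modab_pair h)) = b h.
  have /kerP/= := @rep_cls _ modab_pair h I.
  by rewrite bM1 bV => /eqP; rewrite subr_eq0 => /eqP.
exists (fun q => b (rep q)).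
have fD : {morph (fun q : modab => b (rep q)) : x y / (x + y)%R}.
  by move=> x y /=; rewrite -bM1 -[in LHS](repK x) -[in LHS](repK y) -clsM // brep.
have fn (g : modab -> V) x n : {morph g : x y / (x + y)%R} -> g (x *+ n)%R = (g x *+ n)%R.
  by move=> gD; elim: n => [|n IHn]; rewrite ?morph0 // !mulrS gD IHn.
split=> // [h c|g gD gE q].
  by rewrite (fn (fun q => b (rep q))) // brep -bn natr_Zp.
by rewrite -[in LHS](repK q) -[X in g X]mulr1n /b -gE /modab_tens /= Fp_cast // modn_small // prime_gt1.
Qed.

End ModAb.

Record autAction (K H : groupType) := AutAction {
  aact :> K -> H -> H;
  aact1 : forall h, aact 1 h = h;
  aactM : forall k l h, aact (k * l) h = aact k (aact l h);
  aactMr : forall k h h', aact k (h * h') = aact k h * aact k h' }.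

Definition sdprod (K H : groupType) (a : autAction K H) : Type := (H * K)%type.

Section Semidirect.
Variables (K H : groupType) (a : autAction K H).
Local Notation SD := (sdprod a).

HB.instance Definition _ := Choice.copy SD (H * K)%type.

Definition sd_one : SD := (1, 1).
Definition sd_mul (x y : SD) : SD := (x.1 * a x.2 y.1, x.2 * y.2).
Definition sd_inv (x : SD) : SD := (a x.2^-1 x.1^-1, x.2^-1).

Lemma aact_1r k : a k 1 = 1.
Proof. by apply: (@mulgI _ (a k 1)); rewrite -aactMr !mulg1. Qed.

Lemma sd_mulA : associative sd_mul.
Proof. by move=> x y z; rewrite /sd_mul /= aactMr aactM !mulgA. Qed.

Lemma sd_mul1 : left_id sd_one sd_mul.
Proof. by case=> h k; rewrite /sd_mul /= aact1 !mul1g. Qed.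

Lemma sd_mulr1 : right_id sd_one sd_mul.
Proof. by case=> h k; rewrite /sd_mul /= aact_1r !mulg1. Qed.

Lemma sd_mulV : left_inverse sd_one sd_inv sd_mul.
Proof. by case=> h k; rewrite /sd_mul /= -aactMr !mulVg aact_1r. Qed.

Lemma sd_mulrV : right_inverse sd_one sd_inv sd_mul.
Proof. by case=> h k; rewrite /sd_mul /= -aactM !mulgV aact1 mulgV. Qed.

HB.instance Definition _ :=
  isGroup.Build SD sd_mulA sd_mul1 sd_mulr1 sd_mulV sd_mulrV.

Definition sdl (h : H) : SD := (h, 1).
Definition sdr (k : K) : SD := (1, k).

(* gammaK n is the subset of H whose image in H ><| K is
   [H ><| K, [H ><| K, ... [H ><| K, H]]], with n - 1 commutators. *)
Definition gammaK (n : nat) : set H :=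
  sdl @^-1` iter n.-1 (commsub [set: SD]) (range sdl).

(* The subset A ><| B = A B of H ><| K. *)
Definition sdset (A : set H) (B : set K) : set SD :=
  [set x | A x.1 /\ B x.2].

Definition trivial_on_modab (p : nat) : Prop :=
  forall k h, cls (modab_pair p H) (a k h) = cls (modab_pair p H) h.

Definition compatible (SH : nat -> set H) (SK : nat -> set K) : Prop :=
  forall i j, 0 < i -> 0 < j ->
    commsub (sdr @` SK j) (sdl @` SH i) `<=` sdl @` SH (i + j)%N.

End Semidirect.

Arguments sdset {K H} a A B _.

(* The operations of a graded p-restricted Lie ring, on homogeneous elements.
   The p-map of a sum of elements of different degrees is determined by these
   through Jacobson's formula, so a morphism has to preserve only these. The
   component of index 0 is trivial in all the instances below. *)

Local Open Scope ring_scope.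

Record grLie := GrLie {
  lie_comp :> nat -> zmodType;
  lie_br : forall i j, lie_comp i -> lie_comp j -> lie_comp (i + j)%N }.

Record grRLie (p : nat) := GrRLie {
  rlie_lie :> grLie;
  rlie_pow : forall i, rlie_lie i -> rlie_lie (p * i)%N }.

Arguments lie_br {g i j}.
Arguments rlie_pow {p g i}.

Record is_grRLie_iso (p : nat) (L M : grRLie p) (phi : forall i, L i -> M i) :
  Prop := IsGrRLieIso {
  iso_add : forall i, {morph phi i : x y / x + y};
  iso_bij : forall i, bijective (phi i);
  iso_br : forall i j (x : L i) (y : L j),
    phi (i + j)%N (lie_br x y) = lie_br (phi i x) (phi j y);
  iso_pow : forall i (x : L i), phi (p * i)%N (rlie_pow x) = rlie_pow (phi i x) }.

Section Jacobson.
Variable L : grLie.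

(* Transport along an equality of degrees (0 when the degrees differ). *)
Definition regrade (m n : nat) (x : L m) : L n :=
  if m =P n is ReflectT e then eq_rect m (fun d => L d) x n e else 0.

(* ad(u_1) ... ad(u_r)(x), where u_k is x or y according to the k-th letter *)
Fixpoint adword (i : nat) (x y : L i) (w : seq bool) : L ((size w).+1 * i)%N :=
  match w with
  | [::] => regrade (1 * i)%N x
  | b :: w' => lie_br (if b then x else y) (adword x y w')
  end.

(* The coefficient of t^(j-1) in ad(t x + y)^(p-1)(x). *)
Definition jacobson_coef (p i j : nat) (x y : L i) : L (p * i)%N :=
  \sum_(w : p.-1.-tuple bool | count id w == j.-1)
     regrade (p * i)%N (adword x y w).

(* The sum s_1 + ... + s_(p-1) of Jacobson's formula
     (x + y)^[p] = x^[p] + y^[p] + s_1(x, y) + ... + s_(p-1)(x, y),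
   where j s_j(x, y) is the coefficient above; 1/j is taken in F_p, which is
   meaningful on p-torsion components. *)
Definition jacobson (p i : nat) (x y : L i) : L (p * i)%N :=
  \sum_(1 <= j < p) jacobson_coef p j x y *+ ((j%:R : 'F_p)^-1 : 'F_p).

End Jacobson.

Section Graded.
Variables (p : nat) (G : groupType) (S : npSeries p G).

Let filtS : is_filtration S. Proof. by case: (npseriesP S) => [[]]. Qed.

Lemma series_le m n : (m <= n)%N -> S n `<=` S m.
Proof.
case: filtS => _ _ _ dS /subnKC <-; elim: (n - m)%N => [|k IHk].
  by rewrite addn0.
by rewrite addnS => x /dS/IHk.
Qed.

Lemma series_comm i j a b : S i a -> S j b -> S (i + j)%N (comm a b).
Proof.
have [[_ cS] _] := npseriesP S.
have pos m x : S m x -> S (maxn m 1) x.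
  by case: m => [_|m]; rewrite ?maxn0 ?max0n ?(filt1 filtS) //; rewrite maxnSS maxn0.
move=> /pos Sa /pos Sb.
apply: (@series_le _ (maxn i 1 + maxn j 1)); first by rewrite leq_add ?leq_maxl.
by apply: cS; rewrite ?leq_maxr //; apply: gen_sub; exists a, b.
Qed.

Lemma gr_bot_comm i a b : S i a -> S i b -> S i.+1 (comm a b).
Proof.
case: i => [|i] Sa Sb; first by rewrite (filt1 filtS).
by apply: (@series_le _ (i.+1 + i.+1)); [rewrite addSn addnS ltnS ltnS leq_addr | apply: series_comm].
Qed.

Definition gr_pair (i : nat) : abpair G :=
  AbPair (filt_sg filtS i) (filt_sg filtS i.+1) (@filt_desc _ _ filtS i)
    (@gr_bot_comm i).

Definition gr_comp (i : nat) : zmodType := abquot (gr_pair i).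

Definition gr_cls (i : nat) (g : G) : gr_comp i := cls (gr_pair i) g.

Definition gr_lie : grLie :=
  GrLie (fun i j (x : gr_comp i) (y : gr_comp j) =>
    gr_cls (i + j)%N (comm (rep x) (rep y))).

Lemma gr_brE i j a b : S i a -> S j b ->
  lie_br (gr_cls i a : gr_lie i) (gr_cls j b : gr_lie j)
    = gr_cls (i + j)%N (comm a b).
Proof.
have sS := filt_sg filtS.
have conj m x y : S m y -> S m (x * y * x^-1)%g.
  move=> Sy; have -> : (x * y * x^-1 = comm x y * y)%g by rewrite /comm mulgVK.
  apply: (sgM (sS m)) => //; rewrite -[m]add0n; apply: series_comm => //.
  by rewrite (filt0 filtS).
have eqr m x y z : S m.+1 (x / y)%g -> S m.+1 (y / z)%g -> S m.+1 (x / z)%g.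
  by move=> xy yz; have := sgM (sS _) xy yz; rewrite mulgA mulgVK.
move=> Sa Sb; have [Ra Rb] := (@rep_cls _ (gr_pair i) a Sa, @rep_cls _ (gr_pair j) b Sb).
rewrite /= in Ra Rb; set a' := rep _ in Ra; set b' := rep _ in Rb.
have Sa' : S i a' by apply: (@rep_top _ (gr_pair i)).
have Sb' : S j b' by apply: (@rep_top _ (gr_pair j)).
rewrite [LHS]/= -/a' -/b'.
apply/(@clsP _ (gr_pair (i + j))); try exact: series_comm.
apply: (eqr _ _ (comm a b')).
  have -> : (comm a' b' / comm a b' = comm (a' / a) (a * b' * a^-1))%g.
    by rewrite /comm !invgM !invgK !mulgA !mulgVK.
  by rewrite -addSn; apply: series_comm => //; apply: conj.
have -> : (comm a b' / comm a b = a * comm (b' / b) (b * a^-1 * b^-1) * a^-1)%g.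
  by rewrite /comm !invgM !invgK !mulgA !mulgVK.
apply: (conj _); rewrite addnC -addSn; apply: series_comm => //.
by apply: (conj i); apply: (sgV (sS i)).
Qed.

(* Induced by g |-> g^p; independent of the representative (Lazard). *)
Definition gr : grRLie p :=
  @GrRLie p gr_lie (fun i (x : gr_comp i) => gr_cls (p * i)%N (rep x ^+ p)%g).

End Graded.

Section GradedSemidirect.
Variables (p : nat) (K H : groupType) (a : autAction K H).
Variables (SH : npSeries p H) (SK : npSeries p K).

(* k . h is the class of (k . h) h^-1; the degree n is meant to be i + j. *)
Definition gr_act (n j i : nat) (k : gr SK j) (h : gr SH i) : gr SH n :=
  gr_cls SH n (a (rep k) (rep h) / rep h)%g.

Definition gr_sd_lie : grLie :=
  @GrLie (fun i => (gr SH i * gr SK i)%type : zmodType)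
    (fun i j x y =>
       (lie_br x.1 y.1 + gr_act (i + j)%N x.2 y.1 - gr_act (i + j)%N y.2 x.1,
        lie_br x.2 y.2)).

(* (h, k)^[p] = ((h, 0) + (0, k))^[p], expanded by Jacobson's formula. *)
Definition gr_sd : grRLie p :=
  @GrRLie p gr_sd_lie (fun i (x : gr_sd_lie i) =>
    (rlie_pow x.1, rlie_pow x.2)
    + jacobson p ((x.1, 0) : gr_sd_lie i) ((0, x.2) : gr_sd_lie i)).

End GradedSemidirect.

(* Main.v *)
Require Import Defs.
From HB Require Import structures.
From mathcomp Require Import all_boot all_order all_algebra.
From mathcomp Require Import boolp classical_sets.

(** Let A be the N_p-closure of gamma^K(H). That gamma^[p](H ><| K) is contained
    in A ><| gamma^[p](K) follows once the right-hand side is known to be an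
    N_p-series on H ><| K; the other inclusion holds because the preimages of
    gamma^[p](H ><| K) in H and K are N_p-series. The essential point is that
    gamma_j^[p](K) shifts A by j, that is [gamma_j^[p](K), A_i] is contained in
    A_(i+j). It is obtained by two minimality arguments. First, the elements of
    A_i whose class modulo A_(i+1) is fixed by K form an N_p-series that
    contains gamma^K(H), so they are all of A_i, and K shifts A by one
    ([stabH_Npseries], [gammaK_closure_shift]). Then the elements of K that shift A by
    j form an N_p-series on K, which therefore contains gamma^[p](K) ([stabK_Npseries]).

    If K acts trivially on the abelianization of H modulo p, the first of these
    arguments applies to gamma^[p](H) itself. So K shifts gamma^[p](H) by one,
    gamma^[p](H) contains gamma^K(H), and A = gamma^[p](H).

    In each step the p-th powers require control of (x y)^p. The tool is the
    Hall-Petrescu formula ([hall_petrescu]): x^p y^p = (x y)^p z c, where z is a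
    product of p-th powers of elements of weight at least 2 and c has weight p.
    It comes from the fact that polynomial sequences in a filtered group form a
    group.

    The isomorphism of graded rings sends the class of (h, k) to the pair of
    the classes of h and k. It is additive, bijective and compatible with the
    brackets by direct computation. For the p-maps one needs Jacobson's formula
    in the graded ring of an arbitrary N_p-series ([lazard_formula]), which
    identifies the class of c. The Hall-Petrescu formula is applied
    simultaneously in G and in the group of units of the ring of power series
    over F_p in noncommuting X and Y, to (x, 1 + X) and (y, 1 + Y). The leading
    term of c in the power series is X^p + Y^p - (X + Y)^p, and this is the same
    Lie polynomial as the class of c in G. A Lie polynomial P of degree j in X
    is recovered, up to the factor j, from its associative expansion by
    replacing each word w X by ad(w)(x) and each word w Y by 0: both operations
    are the derivation X |-> X, Y |-> 0 on P. Applied to (X + Y)^p this yields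
    the coefficients in Jacobson's formula, so the free Lie algebra does not
    enter. *)

Set Implicit Arguments.
Unset Strict Implicit.
Unset Printing Implicit Defensive.

Import GRing.Theory.

Local Open Scope classical_set_scope.
Local Open Scope group_scope.

(** * Polynomial sequences and the Hall-Petrescu formula *)

Ltac group_simp := rewrite /comm ?invgM ?invgK ?invg1 ?mulgA
  ?(mulgVK, mulgK, mulVg, mulgV, mul1g, mulg1, invg1).

Section PolynomialSequences.
Variable G : groupType.

(** The index 0 belongs to the chain: the case m = 0 of the commutator condition
    says that R_0 normalises every term, and it is what makes the polynomial
    sequences below a group. *)
Record is_chain (R : nat -> set G) : Prop := IsChain {
  chain_sg : forall m, is_subgroup (R m);
  chain_desc : forall m, R m.+1 `<=` R m;
  chain_comm : forall m n x y, R m x -> R n y -> R (m + n)%N (comm x y) }.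

(** A chain given in positive degrees is prolonged by R_0 = R_1. *)
Lemma chain_of_pos (R : nat -> set G) :
  (forall m, 0 < m -> is_subgroup (R m)) ->
  (forall m, 0 < m -> R m.+1 `<=` R m) ->
  (forall m n x y, 0 < m -> 0 < n -> R m x -> R n y -> R (m + n)%N (comm x y)) ->
  is_chain (fun m => R (maxn m 1)).
Proof.
move=> sR dR cR.
have desc m n : 0 < m -> (m <= n)%N -> R n `<=` R m.
  move=> m0 /subnKC <-; elim: (n - m)%N => [|k IHk]; first by rewrite addn0.
  by rewrite addnS => x /(dR _ (ltn_addr _ m0))/IHk.
have m1 m : (0 < maxn m 1)%N by rewrite leq_maxr.
split=> [m|m|m n x y Rx Ry]; first exact: sR.
- by apply: desc; rewrite // geq_max leq_max leqnSn /= leq_maxr.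
- apply: desc (cR _ _ _ _ (m1 m) (m1 n) Rx Ry) => //.
  by rewrite geq_max leq_add ?leq_maxl //= ltn_addr.
Qed.

Variable R : nat -> set G.
Hypothesis chR : is_chain R.

Lemma chain_le m n : (m <= n)%N -> R n `<=` R m.
Proof.
move=> /subnKC <-; elim: (n - m)%N => [|k IHk]; first by rewrite addn0.
by rewrite addnS => x /(chain_desc chR)/IHk.
Qed.

Implicit Types f g : nat -> G.

Definition delta f (n : nat) : G := f n.+1 * (f n)^-1.

(** Leibman's polynomial sequences, with the condition on iterated differences
    cut off at depth D so that one can argue by induction on D. *)
Fixpoint polyseq (D d : nat) f : Prop :=
  (forall n, R d (f n)) /\
  if D is D'.+1 then polyseq D' d.+1 (delta f) else True.

Lemma polyseq_val D d f : polyseq D d f -> forall n, R d (f n).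
Proof. by case: D => [|D] []. Qed.

Lemma polyseq_ext D d f g : f =1 g -> polyseq D d f -> polyseq D d g.
Proof. by move=> /funext->. Qed.

Lemma polyseq_le D d e f : (d <= e)%N -> polyseq D e f -> polyseq D d f.
Proof.
elim: D d e f => [|D IHD] d e f de [fe] /=; first by split=> // n; apply: chain_le (fe n).
by move=> pf; split=> [n|]; [apply: chain_le (fe n) | apply: (IHD _ e.+1)].
Qed.

Lemma polyseqW D d f : polyseq D.+1 d f -> polyseq D d f.
Proof.
elim: D d f => [|D IHD] d f [fd pf]; split=> //.
exact: IHD.
Qed.

(** The theorem of Lazard and Leibman that polynomial sequences form a group.
    The three closure properties have to be proved together: the difference of
    a product involves a commutator, and the difference of a commutator
    involves products of commutators of larger weight. *)
Lemma polyseq_group D :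
  [/\ forall d f g, polyseq D d f -> polyseq D d g -> polyseq D d (fun n => f n * g n),
      forall d f, polyseq D d f -> polyseq D d (fun n => (f n)^-1)
    & forall d e f g, polyseq D d f -> polyseq D e g ->
        polyseq D (d + e) (fun n => comm (f n) (g n))].
Proof.
elim: D => [|D [pM pV pC]].
  split=> [d f g [fd _] [gd _]|d f [fd _]|d e f g [fd _] [ge _]]; split=> // n.
  - exact: (sgM (chain_sg chR d)).
  - exact: (sgV (chain_sg chR d)).
  - exact: chain_comm.
have pJ d e f g : polyseq D d f -> polyseq D e g ->
    polyseq D e (fun n => f n * g n * (f n)^-1).
  move=> pf pg; apply: polyseq_ext (pM _ _ _ (polyseq_le (leq_addl d e) (pC _ _ _ _ pf pg)) pg).
  by move=> n /=; group_simp.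
split=> [d f g /[dup] /polyseqW pf [fd pf'] [gd pg']|d f /[dup] /polyseqW pf [fd pf']|d e f g].
- split=> [n|]; first by apply: (sgM (chain_sg chR d)).
  apply: polyseq_ext (pM _ _ _ pf' (pJ _ _ _ _ pf pg')) => n.
  by rewrite /delta; group_simp.
- split=> [n|]; first by apply: (sgV (chain_sg chR d)).
  apply: polyseq_ext (pJ _ _ _ _ (pV _ _ pf) (pV _ _ pf')) => n.
  by rewrite /delta; group_simp.
move=> /[dup] /polyseqW pf [fd pf'] /[dup] /polyseqW pg [ge pg'].
split=> [n|]; first exact: chain_comm.
(* With f' f and g' g for the shifted sequences, the difference of [f, g] is
   a product of conjugates of commutators of weight at least d + e + 1. *)
pose F := delta f; pose E := delta g; pose C n := comm (f n) (g n).
have pEg : polyseq D e (fun n => E n * g n).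
  by apply: pM => //; apply: polyseq_le pg'.
have Q1 : polyseq D (d + e).+1 (fun n => comm (f n) (E n)).
  by rewrite -addnS; apply: pC.
have Q2 : polyseq D (d + e).+1 (fun n => comm (F n) (E n * g n)).
  by rewrite -addSn; apply: pC.
have pF1 : polyseq D 1 F by apply: polyseq_le pf'.
have pE1 : polyseq D 1 E by apply: polyseq_le pg'.
have Q3 : polyseq D (d + e).+1 (fun n => comm (F n * E n) (C n)).
  by rewrite -add1n; apply: (pC _ _ _ _ (pM _ _ _ pF1 pE1) (pC _ _ _ _ pf pg)).
have Q4 := pJ _ _ _ _ (pC _ _ _ _ pf pg) Q2.
have := pM _ _ _ (pJ _ _ _ _ pF1 Q1) (pM _ _ _ Q3 Q4).
apply: polyseq_ext => n; rewrite /C /F /E /delta.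
by group_simp.
Qed.

Lemma polyseqM D d f g :
  polyseq D d f -> polyseq D d g -> polyseq D d (fun n => f n * g n).
Proof. by case: (polyseq_group D) => pM _ _; apply: pM. Qed.

Lemma polyseqV D d f : polyseq D d f -> polyseq D d (fun n => (f n)^-1).
Proof. by case: (polyseq_group D) => _ pV _; apply: pV. Qed.

Lemma polyseq_bin D d m c :
  R (d + m)%N c -> polyseq D d (fun n => c ^+ 'C(n, m)).
Proof.
have Rexp e x n : R e x -> R e (x ^+ n).
  move=> ex; elim: n => [|n IHn]; first exact: sg1 (chain_sg chR e).
  by rewrite expgS; apply: (sgM (chain_sg chR e)).
elim: D d m c => [|D IHD] d m c Rc; split=> //; try by move=> n; apply/Rexp/chain_le/Rc/leq_addr.
case: m Rc => [|m] Rc.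
  have -> : delta (fun n => c ^+ 'C(n, 0)) = fun n => 1 ^+ 'C(n, 0).
    by apply/funext => n; rewrite /delta !bin0 mulgV.
  by apply: IHD; apply: sg1 (chain_sg chR _).
have -> : delta (fun n => c ^+ 'C(n, m.+1)) = fun n => c ^+ 'C(n, m).
  by apply/funext => n; rewrite /delta binS addnC expgnDr mulgK.
by apply: IHD; rewrite addSnnS.
Qed.

(** If f vanishes below m then its m-th difference at 0 is f m. *)
Lemma polyseq_first D d m f : (m <= D)%N -> polyseq D d f ->
  (forall n, n < m -> f n = 1) -> R (d + m)%N (f m).
Proof.
elim: m D d f => [|m IHm] D d f; first by move=> _ /polyseq_val fd _; rewrite addn0.
case: D => // D; rewrite ltnS => mD [_ pf] f1.
have <- : delta f m = f m.+1 by rewrite /delta (f1 m) // invg1 mulg1.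
by rewrite addnS -addSn; apply: IHm pf _ => // n nm; rewrite /delta !f1 ?invg1 ?mulg1 // ltnW.
Qed.

(** The sequence n |-> (x y)^-n x^n y^n is polynomial, hence of the form
    c_2^binomial(n,2) c_3^binomial(n,3) ... with c_m in R_m; at n = p all the
    binomial coefficients but the last are divisible by p. *)
Lemma hall_petrescu p x y : prime p -> R 1 x -> R 1 y ->
  exists z c, [/\ powsub p (R 2) z, R p c & x ^+ p * y ^+ p = (x * y) ^+ p * z * c].
Proof.
move=> pr Rx Ry; pose Z := powsub p (R 2).
have sZ : is_subgroup Z by apply: genP.
have px u : R 1 u -> polyseq p 0 (fun n => u ^+ n).
  move=> Ru; have := @polyseq_bin p 0 1 u Ru.
  by apply: polyseq_ext => n; rewrite bin1.
(* Peeling off the binomial factors c_2, ..., c_(m-1) one at a time leaves a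
   polynomial sequence that starts with m trivial terms. *)
have peel m : (2 <= m <= p)%N -> exists f z, [/\ polyseq p 0 f, Z z,
    forall n, n < m -> f n = 1 & x ^+ p * y ^+ p = (x * y) ^+ p * z * f p].
  elim: m => // -[|m] IHm.
    by case/andP.
  case: m IHm => [_ _|m IHm /andP[_ mp]].
    exists (fun n => (x * y) ^- n * (x ^+ n * y ^+ n)), 1; split.
    - apply: polyseqM; first by apply: polyseqV; apply/px/(sgM (chain_sg chR 1)).
      by apply: polyseqM; apply: px.
    - exact: sg1 sZ.
    - by case=> [|[|n]] // _; rewrite ?expg0 ?expg1 ?invg1 ?mulg1 ?mulVg.
    - by rewrite mulg1 mulVKg.
  have [|f [z [pf Zz f1 E]]] := IHm; first by rewrite /= ltnW.
  pose c := f m.+2.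
  have Rc : R m.+2 c by apply: (polyseq_first (ltnW mp) pf f1).
  exists (fun n => (c ^+ 'C(n, m.+2))^-1 * f n), (z * c ^+ 'C(p, m.+2)); split.
  - by apply: polyseqM => //; apply/polyseqV/polyseq_bin.
  - apply: (sgM sZ) => //; have /dvdnP[q ->] : (p %| 'C(p, m.+2))%N.
      by apply: prime_dvd_bin.
    rewrite expgnA; apply: gen_sub; exists (c ^+ q) => //.
    elim: q => [|q IHq]; first exact: sg1 (chain_sg chR 2).
    by rewrite expgS; apply: (sgM (chain_sg chR 2)) => //; apply: chain_le Rc.
  - move=> n; rewrite ltnS leq_eqVlt => /predU1P[->|nm]; first by rewrite binn expg1 mulVg.
    by rewrite bin_small // invg1 mul1g f1.
  - by rewrite E !mulgA mulgK.
have [|f [z [pf Zz f1 E]]] := peel p; first by rewrite prime_gt1 /=.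
by exists z, (f p); split=> //; apply: (polyseq_first (leqnn p) pf f1).
Qed.

End PolynomialSequences.

(** * Units and noncommutative power series *)

Section UnitPairs.
Variable R : pzRingType.

(** A unit is stored together with its inverse, so that inversion needs neither
    a decision procedure nor a choice. *)
Definition unit_pair : Type := {u : R * R | (u.1 * u.2 == 1)%R && (u.2 * u.1 == 1)%R}.
HB.instance Definition _ := Choice.on unit_pair.

Definition upval (u : unit_pair) : R := (val u).1.
Definition upinv (u : unit_pair) : R := (val u).2.

Lemma upvalK u : (upval u * upinv u = 1)%R.
Proof. by case/andP: (valP u) => /eqP. Qed.

Lemma upinvK u : (upinv u * upval u = 1)%R.
Proof. by case/andP: (valP u) => _ /eqP. Qed.

Lemma up_subproof (a b : R) : (a * b = 1)%R -> (b * a = 1)%R ->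
  ((a, b).1 * (a, b).2 == 1)%R && ((a, b).2 * (a, b).1 == 1)%R.
Proof. by move=> /= -> ->; rewrite eqxx. Qed.

Definition mkup (a b : R) (ab : (a * b = 1)%R) (ba : (b * a = 1)%R) : unit_pair :=
  exist _ (a, b) (up_subproof ab ba).

Lemma upval_inj : injective upval.
Proof.
move=> u v uv; apply: val_inj; suff: upinv u = upinv v.
  by move: uv; rewrite /upval /upinv; case: (val u) (val v) => [a b] [c d] /= -> ->.
by rewrite -[LHS]mulr1 -(upvalK v) -uv mulrA upinvK mul1r.
Qed.

Lemma up_mul_subproof u v :
  (upval u * upval v * (upinv v * upinv u) = 1)%R.
Proof. by rewrite mulrA -(mulrA (upval u)) upvalK mulr1 upvalK. Qed.

Lemma up_mul_subproof' u v :
  (upinv v * upinv u * (upval u * upval v) = 1)%R.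
Proof. by rewrite mulrA -(mulrA (upinv v)) upinvK mulr1 upinvK. Qed.

Definition up_mul u v := mkup (up_mul_subproof u v) (up_mul_subproof' u v).
Definition up_one := mkup (mulr1 (1 : R)%R) (mulr1 (1 : R)%R).
Definition up_inv u := mkup (upinvK u) (upvalK u).

Lemma up_mulA : associative up_mul.
Proof. by move=> u v w; apply: upval_inj; apply: mulrA. Qed.
Lemma up_mul1 : left_id up_one up_mul.
Proof. by move=> u; apply: upval_inj; apply: mul1r. Qed.
Lemma up_mulr1 : right_id up_one up_mul.
Proof. by move=> u; apply: upval_inj; apply: mulr1. Qed.
Lemma up_mulV : left_inverse up_one up_inv up_mul.
Proof. by move=> u; apply: upval_inj; apply: upinvK. Qed.
Lemma up_mulrV : right_inverse up_one up_inv up_mul.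
Proof. by move=> u; apply: upval_inj; apply: upvalK. Qed.

HB.instance Definition _ :=
  isGroup.Build unit_pair up_mulA up_mul1 up_mulr1 up_mulV up_mulrV.

Lemma upval1 : upval 1 = 1%R. Proof. by []. Qed.
Lemma upvalM u v : upval (u * v) = (upval u * upval v)%R. Proof. by []. Qed.
Lemma upvalV u : upval u^-1 = upinv u. Proof. by []. Qed.
Lemma upvalX u n : upval (u ^+ n) = (upval u ^+ n)%R.
Proof. by elim: n => // n IHn; rewrite expgS exprS upvalM IHn. Qed.

End UnitPairs.

Local Open Scope ring_scope.

Section PowerSeries.
Variable F : comNzRingType.

(** Power series in two noncommuting variables, as the functions of their
    coefficients on words; the letter true stands for the first variable. *)
Definition ncseries : Type := seq bool -> F.
HB.instance Definition _ := gen_eqMixin ncseries.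
HB.instance Definition _ := gen_choiceMixin ncseries.

Implicit Types f g h : ncseries.

Definition ns_add f g : ncseries := fun w => f w + g w.
Definition ns_opp f : ncseries := fun w => - f w.
Definition ns_zero : ncseries := fun=> 0.

Fact ns_addA : associative ns_add.
Proof. by move=> f g h; apply/funext => w; apply: addrA. Qed.
Fact ns_addC : commutative ns_add.
Proof. by move=> f g; apply/funext => w; apply: addrC. Qed.
Fact ns_add0 : left_id ns_zero ns_add.
Proof. by move=> f; apply/funext => w; apply: add0r. Qed.
Fact ns_addN : left_inverse ns_zero ns_opp ns_add.
Proof. by move=> f; apply/funext => w; apply: addNr. Qed.

HB.instance Definition _ :=
  GRing.isZmodule.Build ncseries ns_addA ns_addC ns_add0 ns_addN.

Definition tails f (b : bool) : ncseries := fun w => f (b :: w).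

(** The Cauchy product, by recursion on the word: its first letter comes from f
    unless f contributes its constant term. *)
Fixpoint conv (w : seq bool) f g : F :=
  f [::] * g w + if w is b :: w' then conv w' (tails f b) g else 0.

Definition ns_mul f g : ncseries := fun w => conv w f g.
Definition ns_one : ncseries := fun w => (w == [::])%:R.

Lemma convDl w f f' g : conv w (f + f') g = conv w f g + conv w f' g.
Proof.
elim: w f f' => [|b w IHw] f f' /=; rewrite mulrDl; first by rewrite !addr0.
have -> : tails (f + f') b = tails f b + tails f' b by [].
by rewrite IHw addrACA.
Qed.

Lemma convDr w f g g' : conv w f (g + g') = conv w f g + conv w f g'.
Proof.
elim: w f => [|b w IHw] f /=; rewrite mulrDr; first by rewrite !addr0.
by rewrite IHw addrACA.
Qed.

Lemma convZ w c f g : conv w (fun w => c * f w) g = c * conv w f g.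
Proof.
elim: w f => [|b w IHw] f /=; rewrite mulrDr mulrA; first by rewrite mulr0.
by rewrite -IHw.
Qed.

Lemma conv0 w g : conv w (fun=> 0) g = 0.
Proof. by elim: w => [|b w IHw] /=; rewrite mul0r add0r //; apply: IHw. Qed.

Fact ns_mulA : associative ns_mul.
Proof.
move=> f g h; apply/funext => w; rewrite /ns_mul.
elim: w f => [|b w IHw] f /=; first by rewrite !addr0 mulrA.
rewrite (_ : tails (fun w => conv w f g) b = ((fun w => f [::] * tails g b w) : ncseries) + ns_mul (tails f b) g) //.
by rewrite convDl convZ IHw mulrDr addr0 mulrA addrA.
Qed.

Fact ns_mul1 : left_id ns_one ns_mul.
Proof.
move=> f; apply/funext => -[|b w]; rewrite /ns_mul /= mul1r ?addr0 //.
by rewrite [X in _ + X]conv0 addr0.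
Qed.

Fact ns_mulr1 : right_id ns_one ns_mul.
Proof.
move=> f; apply/funext => w; rewrite /ns_mul.
elim: w f => [|b w IHw] f /=; first by rewrite mulr1 addr0.
by rewrite mulr0 add0r IHw.
Qed.

Fact ns_mulDl : left_distributive ns_mul +%R.
Proof. by move=> f g h; apply/funext => w; apply: convDl. Qed.
Fact ns_mulDr : right_distributive ns_mul +%R.
Proof. by move=> f g h; apply/funext => w; apply: convDr. Qed.
Fact ns_one_neq0 : ns_one != 0.
Proof. by apply/eqP => /(congr1 (fun f => f [::]))/eqP; rewrite oner_eq0. Qed.

HB.instance Definition _ := GRing.Zmodule_isNzRing.Build ncseries
  ns_mulA ns_mul1 ns_mulr1 ns_mulDl ns_mulDr ns_one_neq0.

Lemma ns0E w : (0 : ncseries) w = 0. Proof. by []. Qed.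
Lemma nsDE f g w : (f + g) w = f w + g w. Proof. by []. Qed.
Lemma nsNE f w : (- f) w = - f w. Proof. by []. Qed.
Lemma ns1E w : (1 : ncseries) w = (w == [::])%:R. Proof. by []. Qed.

Lemma nsME f g w : (f * g) w = conv w f g. Proof. by []. Qed.

Definition ord_ge (n : nat) f : Prop := forall w, (size w < n)%N -> f w = 0.

Lemma ord_ge_le m n f : (m <= n)%N -> ord_ge n f -> ord_ge m f.
Proof. by move=> mn fn w wm; apply: fn; apply: leq_trans mn. Qed.

Lemma ord_geD n f g : ord_ge n f -> ord_ge n g -> ord_ge n (f + g).
Proof. by move=> fn gn w wn; rewrite nsDE fn // gn // addr0. Qed.

Lemma ord_geN n f : ord_ge n f -> ord_ge n (- f).
Proof. by move=> fn w wn; rewrite nsNE fn // oppr0. Qed.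

(** Of the ways to cut a word of length at most m + n in two, only the one at
    position m contributes. *)
Lemma mul_lead m n f g w : ord_ge m f -> ord_ge n g -> (size w <= m + n)%N ->
  (f * g) w = f (take m w) * g (drop m w).
Proof.
move=> fm gn; rewrite nsME.
elim: m f w fm => [|m IHm] f w fm wmn.
  rewrite take0 drop0; case: w wmn => [|b w] wn /=; first by rewrite addr0.
  suff -> : conv w (tails f b) g = 0 by rewrite addr0.
  elim: w (tails f b) wn => [|c w IHw] f' wn /=; rewrite gn ?mulr0 ?addr0 //.
  by rewrite IHw ?addr0 //; apply: ltnW.
case: w wmn => [|b w] wmn /=; rewrite fm // !mul0r add0r //.
by rewrite IHm // => v vm; apply: fm.
Qed.

Lemma ord_geM m n f g : ord_ge m f -> ord_ge n g -> ord_ge (m + n) (f * g).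
Proof.
move=> fm gn w wmn; rewrite (mul_lead fm gn (ltnW wmn)).
case: (ltnP (size w) m) => [wm|mw]; first by rewrite take_oversize ?fm ?mul0r // ltnW.
by rewrite gn ?mulr0 // size_drop ltn_subLR.
Qed.

Lemma ord_geX m n f : ord_ge m f -> ord_ge (n * m) (f ^+ n).
Proof.
by move=> fm; elim: n => [|n IHn] //; rewrite exprS mulSn; apply: ord_geM.
Qed.

Lemma exp_lead n f w : ord_ge 1 f -> size w = n ->
  (f ^+ n) w = \prod_(b <- w) f [:: b].
Proof.
move=> f1 <-; elim: w => [|b w IHw]; first by rewrite big_nil.
rewrite exprS (mul_lead f1 (ord_geX (n := size w) f1)) ?muln1 //=.
by rewrite take0 drop0 IHw big_cons.
Qed.

Definition letter (b : bool) : ncseries := fun w => (w == [:: b])%:R.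
(** The geometric series, which is the inverse of 1 + letter b. *)
Definition geom (b : bool) : ncseries := fun w => if all (pred1 b) w then (-1) ^+ size w else 0.

Lemma ord_letter b : ord_ge 1 (letter b).
Proof. by case. Qed.

Lemma letterP b : (1 + letter b) * geom b = 1.
Proof.
apply/funext => w; rewrite nsME.
have E c : tails (1 + letter b) c = fun w => (c == b)%:R * (1 : ncseries) w.
  apply/funext => v; rewrite /tails nsDE ns1E /letter /= add0r eqseq_cons.
  by case: (c == b); rewrite ?mul1r ?mul0r.
case: w => [|c w] /=; rewrite nsDE ns1E /letter /= ?addr0 ?mul1r ?addr0 // E convZ.
rewrite -nsME mul1r.
rewrite /geom /= exprS mulN1r.
by case: (c == b) => /=; rewrite ?mul1r ?mul0r ?addr0 //; case: ifP => _; rewrite ?addNr ?addr0.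
Qed.

Lemma geomP b : geom b * (1 + letter b) = 1.
Proof.
apply/funext => w; rewrite nsME.
have E c : tails (geom b) c = fun w => (- (c == b)%:R) * geom b w.
  apply/funext => v; rewrite /tails /geom /= exprS.
  by case: (c == b); rewrite /= ?mulN1r ?mulNr ?mul1r ?mul0r ?oppr0 //; case: ifP; rewrite ?oppr0.
elim: w => [|c w IHw] /=; first by rewrite nsDE ns1E /letter /geom /= expr0 !addr0 mulr1.
rewrite E convZ IHw nsDE ns1E /letter /geom /= expr0 mul1r add0r eqseq_cons ns1E.
by case: (c == b); rewrite ?mulN1r ?addrN // ?oppr0 ?mul0r ?addr0.
Qed.

Definition magnus_gen (b : bool) : unit_pair ncseries := mkup (letterP b) (geomP b).

End PowerSeries.

Local Close Scope ring_scope.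

(** * Arithmetic in the graded ring of an N_p-series *)

Section GradedRing.
Variables (p : nat) (G : groupType) (S : npSeries p G).
Local Notation gcl := (gr_cls S).
Local Notation grc := (gr_comp S).

Lemma np_filt : is_filtration S. Proof. by case: (npseriesP S) => [[]]. Qed.
Lemma np_sg i : is_subgroup (S i). Proof. exact: filt_sg np_filt i. Qed.
Lemma np0 g : S 0 g. Proof. by rewrite (filt0 np_filt). Qed.
Lemma np_pow i g : S i g -> S (p * i)%N (g ^+ p).
Proof.
case: i => [|i] Sg; first by rewrite muln0; apply: np0.
by case: (npseriesP S) => _; apply => //; apply: gen_sub; exists g.
Qed.
Lemma np1 i : S i 1. Proof. exact: sg1 (np_sg i). Qed.
Lemma npM i g h : S i g -> S i h -> S i (g * h). Proof. exact: sgM (np_sg i) _ _. Qed.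
Lemma npV i g : S i g -> S i g^-1. Proof. exact: sgV (np_sg i) _. Qed.
Lemma npJ i a g : S i g -> S i (a * g * a^-1).
Proof.
move=> Sg; have -> : a * g * a^-1 = comm a g * g by group_simp.
by apply: npM => //; rewrite -[i]add0n; apply: series_comm => //; apply: np0.
Qed.

Lemma gr_clsM i g h : S i g -> S i h -> gcl i (g * h) = (gcl i g + gcl i h)%R.
Proof. by move=> Sg Sh; apply: clsM. Qed.

Lemma gr_cls1 i : gcl i 1 = 0%R. Proof. exact: cls1. Qed.

Lemma gr_clsV i g : S i g -> gcl i g^-1 = (- gcl i g)%R.
Proof.
by move=> Sg; apply/eqP; rewrite -addr_eq0 -gr_clsM ?mulVg ?gr_cls1 //; apply: npV.
Qed.

Lemma gr_clsX i g n : S i g -> gcl i (g ^+ n) = (gcl i g *+ n)%R.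
Proof.
move=> Sg; elim: n => [|n IHn]; first by rewrite gr_cls1.
rewrite expgS mulrS gr_clsM ?IHn //.
by elim: n {IHn} => [|n IHn]; rewrite ?expgS; [apply: np1 | apply: npM].
Qed.

Lemma gr_cls_eq0 i g : S i.+1 g -> gcl i g = 0%R.
Proof.
move=> Sg; rewrite -(gr_cls1 i); apply/(@clsP _ (gr_pair S i)) => /=.
- exact: filt_desc np_filt _ _ Sg.
- exact: np1.
- by rewrite invg1 mulg1.
Qed.

Lemma gr_clsP i g h : S i g -> S i h -> gcl i g = gcl i h <-> S i.+1 (g / h).
Proof. exact: (@clsP _ (gr_pair S i)). Qed.

Lemma gr_clsJ i a g : S i g -> (0 < i)%N -> gcl i (a * g * a^-1) = gcl i g.
Proof.
move=> Sg i0; apply/gr_clsP => //; first exact: npJ.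
rewrite -add1n; apply: series_comm => //.
by rewrite (filt1 np_filt).
Qed.

Lemma gr_rep i (x : grc i) : S i (rep x).
Proof. exact: (@rep_top _ (gr_pair S i)). Qed.

Lemma gr_repK i (x : grc i) : gcl i (rep x) = x.
Proof. exact: repK. Qed.

Variant gr_spec i : grc i -> Prop := GrSpec g of S i g : gr_spec (gcl i g).

Lemma grP i (x : grc i) : gr_spec x.
Proof. by rewrite -(gr_repK x); split; apply: gr_rep. Qed.

Lemma gr_triv0 (x y : grc 0) : x = y.
Proof.
case: (grP x) => g _; case: (grP y) => h _.
by apply/gr_clsP; rewrite ?(filt1 np_filt) //; apply: np0.
Qed.

Lemma gr_torsion i (x : grc i) : (1 < p)%N -> (0 < i)%N -> (x *+ p = 0)%R.
Proof.
move=> p1 i0; case: (grP x) => g Sg; rewrite -gr_clsX //; apply: gr_cls_eq0.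
by apply: series_le (np_pow Sg); rewrite -[i.+1]addn1 (leq_trans _ (leq_mul p1 (leqnn i))) // mul2n -addnn leq_add2l.
Qed.

Section Bracket.
Variables (N m n : nat) (eN : N = (m + n)%N).

(** The bracket of the graded ring with a free target degree; it is meaningful
    for N' = m' + n', and avoids transports along equalities of degrees. *)
Definition gbr (N' m' n' : nat) (x : grc m') (y : grc n') : grc N' :=
  gcl N' (comm (rep x) (rep y)).

Lemma gbrE a b : S m a -> S n b -> gbr N (gcl m a) (gcl n b) = gcl N (comm a b).
Proof. by rewrite eN => Sa Sb; apply: gr_brE. Qed.

Lemma comm_cls a b : S m a -> S n b -> S N (comm a b).
Proof. by rewrite eN; apply: series_comm. Qed.

Lemma gbrC (x : grc m) (y : grc n) : gbr N x y = (- gbr N y x)%R.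
Proof.
rewrite /gbr -gr_clsV; last by rewrite eN addnC; apply: series_comm; apply: gr_rep.
by congr gr_cls; group_simp.
Qed.

Hypothesis N0 : (0 < N)%N.

Lemma gbrDl (x x' : grc m) (y : grc n) : gbr N (x + x')%R y = (gbr N x y + gbr N x' y)%R.
Proof.
case: (grP x) => a Sa; case: (grP x') => a' Sa'; case: (grP y) => b Sb.
rewrite -gr_clsM // !gbrE //; last exact: npM.
have -> : comm (a * a') b = a * comm a' b * a^-1 * comm a b by group_simp.
rewrite gr_clsM; [|by apply/npJ/comm_cls|exact: comm_cls].
by rewrite gr_clsJ // 1?addrC //; apply: comm_cls.
Qed.

Lemma gbrDr (x : grc m) (y y' : grc n) : gbr N x (y + y')%R = (gbr N x y + gbr N x y')%R.
Proof.
case: (grP x) => a Sa; case: (grP y) => b Sb; case: (grP y') => b' Sb'.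
rewrite -gr_clsM // !gbrE //; last exact: npM.
have -> : comm a (b * b') = comm a b * (b * comm a b' * b^-1) by group_simp.
rewrite gr_clsM; [|exact: comm_cls|by apply/npJ/comm_cls].
by rewrite gr_clsJ //; apply: comm_cls.
Qed.

Lemma gbr0l (y : grc n) : gbr N (0%R : grc m) y = 0%R.
Proof. by apply: (addrI (gbr N (0%R : grc m) y)); rewrite -gbrDl !addr0. Qed.

Lemma gbr0r (x : grc m) : gbr N x (0%R : grc n) = 0%R.
Proof. by apply: (addrI (gbr N x (0%R : grc n))); rewrite -gbrDr !addr0. Qed.

Lemma gbrMnr (x : grc m) (y : grc n) k : gbr N x (y *+ k)%R = (gbr N x y *+ k)%R.
Proof. by elim: k => [|k IHk]; rewrite ?mulr0n ?gbr0r // !mulrS gbrDr IHk. Qed.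

Lemma gbr_suml (y : grc n) I (r : seq I) (P : pred I) (f : I -> grc m) :
  gbr N (\sum_(j <- r | P j) f j)%R y = (\sum_(j <- r | P j) gbr N (f j) y)%R.
Proof. by apply: (big_morph (fun x => gbr N x y)) => [x x'|]; rewrite ?gbrDl ?gbr0l. Qed.

Lemma gbr_sumr (x : grc m) I (r : seq I) (P : pred I) (f : I -> grc n) :
  gbr N x (\sum_(j <- r | P j) f j)%R = (\sum_(j <- r | P j) gbr N x (f j))%R.
Proof. by apply: big_morph => [y y'|]; rewrite ?gbrDr ?gbr0r. Qed.

End Bracket.

(** Expand the commutator of a b = [a, b] b a with c in two ways. *)
Lemma gbr_jacobi m n k mn nk mk N (x : grc m) (y : grc n) (z : grc k) :
  (0 < m)%N -> (0 < n)%N -> (0 < k)%N ->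
  mn = (m + n)%N -> nk = (n + k)%N -> mk = (m + k)%N -> N = (m + n + k)%N ->
  gbr N (gbr mn x y) z = (gbr N x (gbr nk y z) - gbr N y (gbr mk x z))%R.
Proof.
move=> m0 n0 k0 -> -> -> ->.
case: (grP x) => a Sa; case: (grP y) => b Sb; case: (grP z) => c Sc.
have Sab := series_comm Sa Sb; have Sbc := series_comm Sb Sc; have Sac := series_comm Sa Sc.
rewrite (gbrE erefl Sa Sb) (gbrE erefl Sb Sc) (gbrE erefl Sa Sc).
rewrite (gbrE erefl Sab Sc) (gbrE (esym (addnA m n k)) Sa Sbc).
rewrite (@gbrE _ n (m + k) _ _ _ Sb Sac); last by rewrite addnCA addnA.
have Sabc := series_comm Sa Sbc; rewrite addnA in Sabc.
have Sbac := series_comm Sb Sac; rewrite addnCA addnA in Sbac.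
have Sabc' := series_comm Sab Sc.
pose q := comm (b * a) c; pose r := comm a c * comm b c.
have E : comm a (comm b c)
  = comm (comm a b) q * comm b (comm a c) * (r * comm (comm a b) c * r^-1)
    * comm (comm a c) (comm b c).
  by rewrite /q /r; group_simp.
have S1 g : S 1%N g by rewrite (filt1 np_filt).
have Sq : S (1 + k)%N q by apply: series_comm.
have Z1 : S (m + n + k).+1 (comm (comm a b) q).
  by rewrite -addnS; apply: series_comm.
have Z2 : S (m + n + k).+1 (comm (comm a c) (comm b c)).
  apply: series_le (series_comm Sac Sbc).
  by rewrite addnA (addnAC m) -addn1 leq_add2l.
have D g : S (m + n + k).+1 g -> S (m + n + k)%N g by apply: (filt_desc np_filt).
have N0 : (0 < m + n + k)%N by rewrite addn_gt0 k0 orbT.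
move: (comm a (comm b c)) (comm b (comm a c)) (comm (comm a b) c) E Sabc Sbac Sabc' => u v w.
move: (comm _ _) (comm _ _) Z1 Z2 => z1 z2 Z1 Z2 -> _ Sv Sw.
have Sw' := @npJ _ r _ Sw.
have SD1 := npM (D _ Z1) Sv; have SD2 := npM SD1 Sw'.
rewrite (gr_clsM SD2 (D _ Z2)) (gr_clsM SD1 Sw') (gr_clsM (D _ Z1) Sv) gr_clsJ //.
by rewrite (gr_cls_eq0 Z1) (gr_cls_eq0 Z2) add0r addr0 addrAC subrr add0r.
Qed.

Lemma gbrxx N m (x : grc m) : N = (m + m)%N -> gbr N x x = 0%R.
Proof.
by move=> eN; case: (grP x) => a Sa; rewrite gbrE //; group_simp; apply: gr_cls1.
Qed.

End GradedRing.

Local Open Scope ring_scope.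

(** * Words acting on the graded ring *)

(** A sum over a square whose upper triangle vanishes, taken along diagonals. *)
Lemma sum_triangle (V : zmodType) (a : nat -> nat -> V) B :
  (forall j k, (B <= j + k)%N -> a j k = 0) ->
  \sum_(j < B) \sum_(k < B) a j k = \sum_(j < B) \sum_(k < j.+1) a k (j - k)%N.
Proof.
move=> a0.
under [RHS]eq_bigr => j _ do rewrite (big_ord_widen B (fun k => a k (j - k)%N)) //.
rewrite [RHS](exchange_big_dep xpredT) //=; apply: eq_bigr => k _.
transitivity (\sum_(0 + k <= j < B) a k (j - k)%N); last first.
  rewrite add0n -(big_mkord (fun j => k < j.+1)%N (fun j => a k (j - k)%N)).
  rewrite [RHS](big_cat_nat (n := k)) //=; last exact: ltnW.
  have -> : \sum_(0 <= j < k | (k < j.+1)%N) a k (j - k)%N = 0.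
    by rewrite big_nat_cond big1 // => j /andP[/andP[_ jk]]; rewrite ltnS leqNgt jk.
  rewrite add0r.
  by rewrite [RHS]big_nat_cond [LHS]big_nat_cond; apply: eq_bigl => j; rewrite andbT ltnS; case: (k <= j)%N; rewrite ?andbF ?andbT.
rewrite big_addn -(big_mkord xpredT (a k)) (big_cat_nat (n := B - k)) ?leq_subr //=.
have -> : \sum_(B - k <= j < B) a k j = 0.
  by rewrite big_nat_cond big1 // => j /andP[/andP[jk _] _]; apply: a0; rewrite -leq_subLR.
rewrite addr0.
by apply: eq_bigr => j _; rewrite addnK.
Qed.

Section WordSums.
Variable V : zmodType.
Implicit Types F : seq bool -> V.

(** The sum over all words of length m. The recursion makes the splitting of
    words of length m + n definitional in the first factor. *)
Fixpoint wsum (m : nat) F : V :=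
  if m is m'.+1 then wsum m' (fun w => F (true :: w)) + wsum m' (fun w => F (false :: w))
  else F [::].

Lemma eq_wsum m F F' : (forall w, size w = m -> F w = F' w) -> wsum m F = wsum m F'.
Proof.
elim: m F F' => [|m IHm] F F' FF' /=; first exact: FF'.
by congr (_ + _); apply: IHm => w wm; apply: FF'; rewrite /= wm.
Qed.

Lemma wsum0 m : wsum m (fun=> 0) = 0.
Proof. by elim: m => [|m /= ->] //; rewrite addr0. Qed.

Lemma wsumD m F F' : wsum m (fun w => F w + F' w) = wsum m F + wsum m F'.
Proof. by elim: m F F' => [|m IHm] F F' //=; rewrite !IHm addrACA. Qed.

Lemma wsum_cat m n F : wsum (m + n) F = wsum m (fun w => wsum n (fun w' => F (w ++ w'))).
Proof. by elim: m F => [|m IHm] F //=; rewrite !IHm. Qed.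

Lemma wsum_rcons m F :
  wsum m.+1 F = wsum m (fun w => F (rcons w true) + F (rcons w false)).
Proof.
by rewrite -addn1 wsum_cat; apply: eq_wsum => w _; rewrite /= !cats1.
Qed.

Lemma wsum_tuple m F : wsum m F = \sum_(w : m.-tuple bool) F w.
Proof.
elim: m F => [|m IHm] F /=.
  by rewrite (big_pred1 [tuple]) // => w; apply/esym/eqP; apply: tuple0.
transitivity (\sum_(b : bool) \sum_(w : m.-tuple bool) F (b :: w)).
  by rewrite big_bool !IHm.
rewrite pair_big /=.
rewrite (reindex (fun bw : bool * m.-tuple bool => [tuple of bw.1 :: bw.2])) //=.
exists (fun w : m.+1.-tuple bool => (thead w, [tuple of behead w])) => [[b w]|w] _ /=.
  by congr pair; apply: val_inj.
by apply: val_inj; rewrite /= [in RHS](tuple_eta w).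
Qed.

End WordSums.

Lemma wsum_morph (V W : zmodType) (h : V -> W) m F :
  {morph h : x y / x + y} -> h (wsum m F) = wsum m (fun w => h (F w)).
Proof. by move=> hD; elim: m F => [|m IHm] F //=; rewrite hD !IHm. Qed.

Section FpScale.
Variables (p : nat) (pr : prime p) (V : zmodType).
Hypothesis tors : forall z : V, z *+ p = 0.

Lemma mulrFp_nat (z : V) n : z *+ (n%:R : 'F_p)%R = z *+ n.
Proof. by rewrite val_Fp_nat // [in RHS](divn_eq n p) mulrnDr mulnC mulrnA tors mul0rn add0r. Qed.

Lemma mulrFpD (z : V) (c d : 'F_p) : z *+ (c + d)%R = z *+ c + z *+ d.
Proof. by rewrite -{1}(natr_Zp c) -{1}(natr_Zp d) -natrD mulrFp_nat mulrnDr. Qed.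

Lemma mulrFpM (z : V) (c d : 'F_p) : z *+ (c * d)%R = z *+ d *+ c.
Proof. by rewrite -{1}(natr_Zp c) -{1}(natr_Zp d) -natrM mulrFp_nat mulnC mulrnA. Qed.

Lemma mulrFpN (z : V) (c : 'F_p) : z *+ (- c)%R = - (z *+ c).
Proof. by apply/eqP; rewrite -addr_eq0 -mulrFpD addNr. Qed.

End FpScale.

Section WordAction.
Variables (p : nat) (pr : prime p) (G : groupType) (S : npSeries p G).
Variables (i : nat) (i0 : (0 < i)%N) (x y : G) (Sx : S i x) (Sy : S i y).
Local Notation gcl := (gr_cls S).
Local Notation grc := (gr_comp S).

Definition ltr (b : bool) : G := if b then x else y.
Definition adw (w : seq bool) (g : G) : G := foldr (fun b => comm (ltr b)) g w.

Lemma ltr_in b : S i (ltr b). Proof. by case: b. Qed.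

Lemma adw_in n w g : S n g -> S (size w * i + n)%N (adw w g).
Proof.
move=> Sg; elim: w => [|b w IHw] //=.
by rewrite mulSn -addnA; apply: series_comm => //; apply: ltr_in.
Qed.

(** The operator ad(w_1) ... ad(w_r) on the graded ring, again with a free
    target degree. *)
Definition wact (n N : nat) (w : seq bool) (l : grc n) : grc N := gcl N (adw w (rep l)).

Lemma wactE n N w g : N = (size w * i + n)%N -> S n g ->
  wact N w (gcl n g) = gcl N (adw w g).
Proof.
elim: w N => [|b w IHw] N -> Sg; first by rewrite /wact /= mul0n add0n gr_repK.
have := IHw _ erefl Sg; rewrite /wact /= => E.
have eN : ((size w).+1 * i + n = i + (size w * i + n))%N by rewrite mulSn addnA.
rewrite -(gbrE eN (ltr_in b) (adw_in w Sg)).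
by rewrite -(gbrE eN (ltr_in b) (adw_in w (gr_rep _))) E.
Qed.

Lemma wact_nil n (l : grc n) : wact n [::] l = l.
Proof. exact: gr_repK. Qed.

Lemma wact_cons n N M b w (l : grc n) : N = (i + M)%N -> M = (size w * i + n)%N ->
  wact N (b :: w) l = gbr N (gcl i (ltr b)) (wact M w l).
Proof.
move=> eN eM; rewrite /wact (gbrE eN) //; first exact: ltr_in.
by rewrite eM; apply/adw_in/gr_rep.
Qed.

Lemma wactD n N w (l l' : grc n) : (0 < n)%N -> N = (size w * i + n)%N ->
  wact N w (l + l') = wact N w l + wact N w l'.
Proof.
move=> n0; elim: w N => [|b w IHw] N -> /=; first by rewrite mul0n !wact_nil.
have eN : ((size w).+1 * i + n = i + (size w * i + n))%N by rewrite mulSn addnA.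
rewrite !(wact_cons _ _ eN erefl) (IHw _ erefl) (gbrDr eN) //.
by rewrite addn_gt0 n0 orbT.
Qed.

Lemma wactMn n N w (l : grc n) k : (0 < n)%N -> N = (size w * i + n)%N ->
  wact N w (l *+ k) = wact N w l *+ k.
Proof.
move=> n0 eN; have w0 : wact N w (0 : grc n) = 0.
  by apply: (addrI (wact N w (0 : grc n))); rewrite -(wactD _ _ n0 eN) !addr0.
by elim: k => [|k IHk]; rewrite ?mulr0n // !mulrS wactD // IHk.
Qed.

Lemma wact_cat n N M w w' (l : grc n) : M = (size w' * i + n)%N ->
  N = (size w * i + M)%N -> wact N (w ++ w') l = wact N w (wact M w' l).
Proof.
move=> -> ->; case: (grP l) => g Sg; rewrite !wactE //.
- by rewrite /adw foldr_cat.
- exact: adw_in.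
- by rewrite size_cat mulnDl addnA.
Qed.

(** The values on words of the derivation of the free Lie ring that maps x to x
    and y to 0, extended to the free associative ring: only the words that end
    in x contribute. *)
Definition dw (w : seq bool) : G :=
  adw (take (size w).-1 w) (if last false w then x else 1%g).

Lemma dw_rcons w b : dw (rcons w b) = adw w (if b then x else 1%g).
Proof. by rewrite /dw size_rcons last_rcons -cats1 take_size_cat. Qed.

Lemma adw1 w : adw w 1%g = 1%g.
Proof. by elim: w => [|b w /= ->] //; group_simp. Qed.

Lemma dw_cat w w' : w' != [::] -> dw (w ++ w') = adw w (dw w').
Proof. by case/lastP: w' => // w' b _; rewrite -rcons_cat !dw_rcons /adw foldr_cat. Qed.

Lemma dw_in w : S (size w * i)%N (dw w).
Proof.
case/lastP: w => [|w b]; first exact: np0.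
rewrite dw_rcons size_rcons mulSnr; apply: adw_in.
by case: b => //; apply: np1.
Qed.

(** Evaluation of the homogeneous component of degree m of a power series
    v: as an operator on the graded ring ([act]), and through the extended
    derivation ([der]). *)
Definition act (n N m : nat) (v : seq bool -> 'F_p) (l : grc n) : grc N :=
  wsum m (fun w => wact N w l *+ v w).
Definition der (N m : nat) (v : seq bool -> 'F_p) : grc N :=
  wsum m (fun w => gcl N (dw w) *+ v w).

Lemma gr_tors N : (0 < N)%N -> forall z : grc N, z *+ p = 0.
Proof. by move=> N0 z; apply: gr_torsion => //; apply: prime_gt1. Qed.

Section Linear.
Variables (n N m : nat) (N0 : (0 < N)%N).
Let tors := gr_tors N0.

Lemma eq_act v v' (l : grc n) : (forall w, size w = m -> v w = v' w) ->
  act N m v l = act N m v' l.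
Proof. by move=> vv'; apply: eq_wsum => w wm; rewrite vv'. Qed.

Lemma act_sum (l : grc n) I (r : seq I) (v : I -> seq bool -> 'F_p) :
  act N m (fun w => \sum_(k <- r) v k w) l = \sum_(k <- r) act N m (v k) l.
Proof.
elim: r => [|k r IHr]; first by rewrite big_nil -[RHS](wsum0 _ m); apply: eq_wsum => w _; rewrite big_nil.
rewrite big_cons -IHr -wsumD; apply: eq_wsum => w _.
by rewrite big_cons (mulrFpD pr tors).
Qed.

Lemma actD v v' (l : grc n) : act N m (fun w => v w + v' w) l = act N m v l + act N m v' l.
Proof. by rewrite -wsumD; apply: eq_wsum => w _; rewrite (mulrFpD pr tors). Qed.

Lemma actN v (l : grc n) : act N m (fun w => - v w) l = - act N m v l.
Proof.
by apply/eqP; rewrite -addr_eq0 -actD -[eqbRHS](wsum0 _ m); apply/eqP/eq_wsum => w _; rewrite addNr.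
Qed.

Lemma eq_der v v' : (forall w, size w = m -> v w = v' w) ->
  der N m v = der N m v'.
Proof. by move=> vv'; apply: eq_wsum => w wm; rewrite vv'. Qed.

Lemma der_sum I (r : seq I) (v : I -> seq bool -> 'F_p) :
  der N m (fun w => \sum_(k <- r) v k w) = \sum_(k <- r) der N m (v k).
Proof.
elim: r => [|k r IHr]; first by rewrite big_nil -[RHS](wsum0 _ m); apply: eq_wsum => w _; rewrite big_nil.
rewrite big_cons -IHr -wsumD; apply: eq_wsum => w _.
by rewrite big_cons (mulrFpD pr tors).
Qed.

Lemma derD v v' : der N m (fun w => v w + v' w) = der N m v + der N m v'.
Proof. by rewrite -wsumD; apply: eq_wsum => w _; rewrite (mulrFpD pr tors). Qed.

Lemma derN v : der N m (fun w => - v w) = - der N m v.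
Proof.
by apply/eqP; rewrite -addr_eq0 -derD -[eqbRHS](wsum0 _ m); apply/eqP/eq_wsum => w _; rewrite addNr.
Qed.

End Linear.

Definition mulw (m : nat) (v v' : seq bool -> 'F_p) : seq bool -> 'F_p :=
  fun w => v (take m w) * v' (drop m w).

Lemma wact_wsum n N w m (F : seq bool -> grc n) : (0 < n)%N -> N = (size w * i + n)%N ->
  wact N w (wsum m F) = wsum m (fun w' => wact N w (F w')).
Proof. by move=> n0 eN; apply: wsum_morph => l l'; apply: wactD. Qed.

Lemma act_mul n N M m m' v v' (l : grc n) : (0 < n)%N ->
  M = (m' * i + n)%N -> N = (m * i + M)%N ->
  act N (m + m') (mulw m v v') l = act N m v (act M m' v' l).
Proof.
move=> n0 eM eN; rewrite /act wsum_cat; apply: eq_wsum => w wm.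
have M0 : (0 < M)%N by rewrite eM addn_gt0 n0 orbT.
have N0 : (0 < N)%N by rewrite eN addn_gt0 M0 orbT.
rewrite wact_wsum ?wm // [RHS](wsum_morph _ _ (h := fun z => z *+ v w)); last first.
  by move=> z z'; apply: mulrnDl.
apply: eq_wsum => w' wm'; rewrite wactMn ?wm // -(mulrFpM pr (gr_tors N0)).
by rewrite /mulw take_size_cat // drop_size_cat // -wact_cat ?wm ?wm'.
Qed.

(** The derivation rule: only the letters of the second factor can be last. *)
Lemma der_mul N m m' v v' : (0 < m')%N -> N = (m * i + m' * i)%N ->
  der N (m + m') (mulw m v v') = act N m v (der (m' * i) m' v').
Proof.
move=> m0 eN; rewrite /der /act wsum_cat; apply: eq_wsum => w wm.
have M0 : (0 < m' * i)%N by rewrite muln_gt0 m0.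
have N0 : (0 < N)%N by rewrite eN addn_gt0 M0 orbT.
rewrite wact_wsum ?wm // [RHS](wsum_morph _ _ (h := fun z => z *+ v w)); last first.
  by move=> z z'; apply: mulrnDl.
apply: eq_wsum => w' wm'; rewrite wactMn ?wm // -(mulrFpM pr (gr_tors N0)).
rewrite /mulw take_size_cat // drop_size_cat // dw_cat ?wactE ?wm //.
- by rewrite -wm'; apply: dw_in.
- by rewrite -size_eq0 wm' -lt0n.
Qed.

(** The component of f of degree j in the first variable. *)
Definition part (j : nat) (f : ncseries 'F_p) : seq bool -> 'F_p :=
  fun w => if count id w == j then f w else 0.

Lemma part_mul j m n (f f' : ncseries 'F_p) w : ord_ge m f -> ord_ge n f' ->
  size w = (m + n)%N ->
  part j (f * f') w = \sum_(k < j.+1) mulw m (part k f) (part (j - k) f') w.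
Proof.
move=> fm fn wmn; rewrite /part (mul_lead fm fn) ?wmn // /mulw.
rewrite -[in count id w](cat_take_drop m w) count_cat.
move: (take m w) (drop m w) => w1 w2; set c := count id w1; set d := count id w2.
case: eqP => [<-|cd].
  rewrite (bigD1 (inord c)) //= inordK ?ltnS ?leq_addr // eqxx addKn eqxx.
  rewrite big1 ?addr0 // => k /eqP kc; case: eqP => [ck|_]; last by rewrite mul0r.
  by case: kc; apply: val_inj; rewrite /= inordK // ltnS leq_addr.
rewrite big1 // => k _; case: eqP => [ck|]; last by rewrite mul0r.
by case: eqP => [dk|]; rewrite ?mulr0 //; case: cd; rewrite ck dk subnKC // -ltnS.
Qed.

End WordAction.

(** * Lie elements in the Magnus group *)

Section LieElements.
Variables (p : nat) (pr : prime p) (G : groupType) (S : npSeries p G).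
Variables (i : nat) (i0 : (0 < i)%N) (x y : G) (Sx : S i x) (Sy : S i y).
Local Notation gcl := (gr_cls S).
Local Notation grc := (gr_comp S).
Local Notation FS := (ncseries 'F_p).
Local Notation actv := (act x y).
Local Notation derv := (der S x y).

(** The component of degree m of f is the same Lie polynomial as the sum of the
    t_j, where t_j has degree j in x. No free Lie ring is needed to say so: it
    is enough that f acts as ad(t_j), and that the derivation that kills y
    multiplies t_j by j. In degree at least 2 a Lie polynomial has no
    component of degree 0 in one of the variables ([lead_ends]); the
    derivation could not determine these components when m = p. *)
Record lead (m : nat) (f : FS) (t : nat -> grc (m * i)) : Prop := Lead {
  lead_act : forall j n N (l : grc n), (0 < n)%N -> N = (m * i + n)%N ->
    actv N m (part j f) l = gbr N (t j) l;
  lead_der : forall j, derv (m * i) m (part j f) = t j *+ j;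
  lead_big : forall j, (m < j)%N -> t j = 0;
  lead_ends : (1 < m)%N -> t 0%N = 0 /\ t m = 0 }.

Lemma partD j (f f' : FS) : part j (f + f') = fun w => part j f w + part j f' w.
Proof. by apply/funext => w; rewrite /part; case: eqP => _; rewrite ?addr0. Qed.

Lemma partN j (f : FS) : part j (- f) = fun w => - part j f w.
Proof. by apply/funext => w; rewrite /part; case: eqP => _; rewrite ?oppr0. Qed.

Section Degree.
Variables (m : nat) (m0 : (0 < m)%N).

Lemma mi_gt0 : (0 < m * i)%N. Proof. by rewrite muln_gt0 m0. Qed.

Lemma lead_ext (f f' : FS) t : (forall w, size w = m -> f w = f' w) -> lead (m := m) f t -> lead f' t.
Proof.
have E : (forall w, size w = m -> f w = f' w) ->
    forall j w, size w = m -> part j f' w = part j f w.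
  by move=> ff' j w wm; rewrite /part ff'.
move=> /E {}E [ta td tb te]; split=> // [j n N l n0 eN|j].
  by rewrite -ta //; apply: eq_act => w; apply: E.
by rewrite -td //; apply: eq_der => w; apply: E.
Qed.

Lemma lead0 : lead (m := m) 0 (fun=> 0).
Proof.
split=> // [j n N l n0 eN|j].
  have N0 : (0 < N)%N by rewrite eN addn_gt0 n0 orbT.
  rewrite (gbr0l eN) // -[RHS](wsum0 _ m); apply: eq_wsum => w _.
  by rewrite /part if_same.
rewrite mul0rn -[RHS](wsum0 _ m); apply: eq_wsum => w _.
by rewrite /part if_same.
Qed.

Lemma leadD f f' t t' : lead f t -> lead f' t' ->
  lead (m := m) (f + f') (fun j => t j + t' j).
Proof.
move=> [ta td tb te] [ta' td' tb' te'].
split=> [j n N l n0 eN|j|j mj|m1].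
- have N0 : (0 < N)%N by rewrite eN addn_gt0 n0 orbT.
  by rewrite partD (actD pr) // (gbrDl eN) // ta // ta'.
- by rewrite partD (derD pr) ?mi_gt0 // td td' mulrnDl.
- by rewrite tb // tb' // addr0.
- by have [-> ->] := te m1; have [-> ->] := te' m1; rewrite addr0.
Qed.

Lemma leadN f t : lead f t -> lead (m := m) (- f) (fun j => - t j).
Proof.
move=> [ta td tb te]; split=> [j n N l n0 eN|j|j mj|m1].
- have N0 : (0 < N)%N by rewrite eN addn_gt0 n0 orbT.
  rewrite partN (actN pr) // ta //; apply/eqP; rewrite -subr_eq0 -opprD oppr_eq0.
  by rewrite -(gbrDl eN) // addrN (gbr0l eN).
- by rewrite partN (derN pr) ?mi_gt0 // td mulNrn.
- by rewrite tb // oppr0.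
- by have [-> ->] := te m1; rewrite oppr0.
Qed.

End Degree.

Lemma act_letter n N (b : bool) f (l : grc n) : N = (i + n)%N ->
  actv N 1 (part b f) l = gbr N (gcl i (ltr x y b)) l *+ f [:: b].
Proof.
move=> eN; have E c : wact x y N [:: c] l = gbr N (gcl i (ltr x y c)) l.
  by rewrite (wact_cons Sx Sy (M := n) (w := [::]) c l eN erefl) wact_nil.
by rewrite /act /= !E /part /=; case: b; rewrite /= ?mulr0n ?addr0 ?add0r.
Qed.

(** Both components are multiples of the same letter; this gives the base case
    of [lead_ends]. *)
Lemma lead1_parallel (b : bool) f f' t t' N : lead (m := 1) f t -> lead (m := 1) f' t' ->
  N = (1 * i + 1 * i)%N -> gbr N (t b) (t' b) = 0.
Proof.
move=> [ta _ _ _] [ta' _ _ _] eN.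
have e1 : (i + i = i + 1 * i)%N by rewrite mul1n.
have e2 : (i + i = 1 * i + i)%N by rewrite mul1n.
have e3 : N = (i + i)%N by rewrite eN mul1n.
subst N; rewrite -ta ?mul1n // act_letter ?mul1n // (gbrC (n := 1 * i)) //.
rewrite -ta' ?mul1n // act_letter // gbrxx // mul0rn.
by rewrite oppr0 mul0rn.
by rewrite mul1n.
Qed.

(** The leading term of a commutator is the commutator of the leading terms:
    [lead_act] is then the Jacobi identity, and [lead_der] is the rule
    D [s, t] = [s, D t] - [t, D s], which adds the degrees in x. *)
Lemma lead_comm m n f f' t t' : (0 < m)%N -> (0 < n)%N -> ord_ge m f -> ord_ge n f' ->
  lead (m := m) f t -> lead (m := n) f' t' ->
  lead (m := m + n) (f * f' - f' * f)
    (fun j => \sum_(k < j.+1) gbr ((m + n) * i) (t k) (t' (j - k)%N)).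
Proof.
move=> m0 n0 fm fn lt lt'; have [ta td tb te] := lt; have [ta' td' tb' te'] := lt'.
have mi0 := mi_gt0 m0; have ni0 := mi_gt0 n0.
have mn0 : (0 < (m + n) * i)%N by rewrite muln_gt0 addn_gt0 m0.
have eMN : ((m + n) * i = m * i + n * i)%N by rewrite mulnDl.
have eNM : ((m + n) * i = n * i + m * i)%N by rewrite eMN addnC.
have rev_sum j (V : zmodType) (F : nat -> nat -> V) :
    \sum_(k < j.+1) F k (j - k)%N = \sum_(k < j.+1) F (j - k)%N k.
  rewrite [LHS](reindex_inj rev_ord_inj) /=; apply: eq_bigr => k _.
  by rewrite subSS subKn // -ltnS.
have Em j w : size w = (m + n)%N -> part j (f * f' - f' * f) w =
    \sum_(k < j.+1) mulw m (part k f) (part (j - k) f') w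
    + - \sum_(k < j.+1) mulw n (part (j - k) f') (part k f) w.
  move=> wmn; rewrite partD partN (part_mul _ fm fn) // (part_mul _ fn fm) ?wmn 1?addnC //.
  by congr (_ - _); rewrite (rev_sum _ _ (fun a b => mulw n (part b f') (part a f) w)).
split=> [j k N l k0 eN|j|j mnj|_].
- have N0 : (0 < N)%N by rewrite eN addn_gt0 k0 orbT.
  have eN1 : N = (m * i + (n * i + k))%N by rewrite eN mulnDl addnA.
  have eN2 : N = (n * i + (m * i + k))%N by rewrite eN1 addnCA.
  rewrite (eq_act x y N l (@Em j)) (actD pr) // (actN pr) // !(act_sum pr) // -sumrB.
  rewrite (gbr_suml eN) //; apply: eq_bigr => q _.
  have := act_mul pr Sx Sy (part (j - q) f') (part q f) l k0 erefl eN2.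
  rewrite [(n + m)%N]addnC (act_mul pr Sx Sy _ _ _ k0 erefl eN1) => ->.
  rewrite !(ta, ta') ?addn_gt0 ?k0 ?orbT //.
  rewrite (gbr_jacobi (mn := (m + n) * i) (nk := n * i + k) (mk := m * i + k)) //.
  by rewrite eN eMN.
- rewrite (eq_der S x y _ (@Em j)) (derD pr) // (derN pr) // !(der_sum pr) // -sumrB.
  rewrite -sumrMnl; apply: eq_bigr => q _.
  have := der_mul pr i0 Sx Sy (part (j - q) f') (part q f) m0 eNM.
  rewrite [in der _ _ _ _ (n + m)](addnC n m) (der_mul pr i0 Sx Sy _ _ n0 eMN) => ->.
  rewrite td td' ta // ta' // (gbrMnr eMN) // (gbrMnr eNM) //.
  rewrite (gbrC eNM) mulNrn opprK -mulrnDr subnK //; last by rewrite -ltnS.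
- rewrite big1 // => q _; case: (ltnP m q) => [/tb->|qm]; first exact: gbr0l eMN mn0 _.
  rewrite tb' ?(gbr0r eMN) //.
  by rewrite ltn_subRL (leq_ltn_trans _ mnj) // leq_add2r.
- have par : (1 < m)%N || (1 < n)%N \/ m = 1%N /\ n = 1%N.
    by case: m m0 {te td ta tb lt fm mi0 mn0 eMN eNM Em} t => [|[|m']] //; case: n n0 {te' td' ta' tb' lt' fn ni0} t' => [|[|n']] //; auto.
  split.
    rewrite big_ord_recl big_ord0 addr0 subn0.
    case: par => [/orP[m1|n1]|[m1 n1]].
    + by rewrite (te m1).1 (gbr0l eMN).
    + by rewrite (te' n1).1 (gbr0r eMN).
    + subst m n; exact: (lead1_parallel false lt lt' eMN).
  rewrite (bigD1 (inord m)) //= big1 ?addr0 => [|q /eqP qm].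
    rewrite inordK ?ltnS ?leq_addr // addKn.
    case: par => [/orP[m1|n1]|[m1 n1]].
    + by rewrite (te m1).2 (gbr0l eMN).
    + by rewrite (te' n1).2 (gbr0r eMN).
    + subst m n; exact: (lead1_parallel true lt lt' eMN).
  case: (ltngtP m q) => [/tb->|qm'|mq]; first exact: gbr0l eMN mn0 _.
    by rewrite tb' ?(gbr0r eMN) // ltn_subRL ltn_add2r.
  by case: qm; apply: val_inj; rewrite /= inordK ?ltnS ?leq_addr.
Qed.

End LieElements.

Section Congruence.
Variable F : comNzRingType.
Local Notation FS := (ncseries F).
Local Notation U := (unit_pair FS).
Implicit Types u v : U.

Definition congr_sub (m : nat) : set U := [set u | ord_ge m (upval u - 1)].

Lemma mul1D_sub1 (a b : FS) : (1 + a) * (1 + b) - 1 = a + b + a * b.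
Proof. by rewrite mulrDl mul1r mulrDr mulr1 addrAC [1 + b]addrC addrK addrA (addrC b). Qed.

Lemma up_sub1M u v : upval (u * v)%g - 1
  = (upval u - 1) + (upval v - 1) + (upval u - 1) * (upval v - 1).
Proof. by rewrite -mul1D_sub1 !(addrC 1) !subrK. Qed.

Lemma up_sub1V u : upval u^-1%g - 1 = - (upval u - 1) * upval u^-1%g.
Proof. by rewrite mulNr mulrBl mul1r upvalV upvalK opprB. Qed.

(** From (c - 1) v u = u v - v u for the commutator c of u and v. *)
Lemma up_sub1C u v : upval (comm u v) - 1
  = ((upval u - 1) * (upval v - 1) - (upval v - 1) * (upval u - 1)) * upval (v * u)^-1%g.
Proof.
have -> : (upval u - 1) * (upval v - 1) - (upval v - 1) * (upval u - 1)
    = upval (u * v)%g - upval (v * u)%g.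
  have -> : upval (u * v)%g - upval (v * u)%g
      = (upval (u * v)%g - 1) - (upval (v * u)%g - 1) by rewrite opprB addrA subrK.
  by rewrite !up_sub1M [in RHS](addrC (upval v - 1)) [in RHS]opprD addrACA subrr add0r.
rewrite mulrBl -!upvalM mulgV upval1; congr (upval _ - 1).
by group_simp.
Qed.

Lemma mulr_sub1 (f g : FS) : f * g = f * (g - 1) + f.
Proof. by rewrite mulrBr mulr1 subrK. Qed.

Lemma ord_geM0 m (f g : FS) : ord_ge m f -> ord_ge m (f * g).
Proof. by move=> fm; rewrite -[m]addn0; apply: ord_geM. Qed.

Lemma congr_sub_sg m : is_subgroup (congr_sub m).
Proof.
rewrite /congr_sub; split=> /= [|u v um vm|u um].
- by rewrite subrr.
- by rewrite up_sub1M; apply: ord_geD; [apply: ord_geD | apply: ord_geM0].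
- by rewrite up_sub1V; apply/ord_geM0/ord_geN.
Qed.

End Congruence.

Section LieChain.
Variables (p : nat) (pr : prime p).
Local Notation FS := (ncseries 'F_p).

Lemma ncseries_pchar : p \in [pchar FS].
Proof.
apply/andP; split=> //; apply/eqP/funext => w.
have E n : (n%:R : FS) w = (w == [::])%:R *+ n.
  by elim: n => [|n IHn]; rewrite ?mulr0n ?mulr1n // !mulrS nsDE IHn.
by rewrite E ns0E -mulr_natr pchar_Fp_0 // mulr0.
Qed.

Lemma ncseries_frobenius (f : FS) : (1 + f) ^+ p = 1 + f ^+ p.
Proof.
have := pFrobenius_autD_comm ncseries_pchar (commr1 f : GRing.comm f 1).
by rewrite !pFrobenius_autE expr1n addrC => ->; rewrite addrC.
Qed.

Variables (G : groupType) (S : npSeries p G).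
Variables (i : nat) (i0 : (0 < i)%N) (x y : G) (Sx : S i x) (Sy : S i y).
Local Notation gcl := (gr_cls S).
Local Notation grc := (gr_comp S).
Local Notation M := (unit_pair FS).

(** Pairs of an element of G and an element of the Magnus group whose leading
    terms are given by one Lie polynomial in two letters. *)
Definition lie_chain (m : nat) : set (G * M)%type :=
  [set gu | [/\ S (m * i)%N gu.1, @congr_sub 'F_p m gu.2 &
    exists t : nat -> grc (m * i), lead x y (upval gu.2 - 1) t /\
      forall B, (m < B)%N -> gcl (m * i) gu.1 = \sum_(j < B) t j]].

Lemma lie_chain_sg m : (0 < m)%N -> is_subgroup (lie_chain m).
Proof.
move=> m0; have sC := @congr_sub_sg 'F_p m.
split=> [|[g u] [h v] [/= Sg Cu [t [lt gt]]] [/= Sh Cv [t' [lt' ht]]]|[g u] [/= Sg Cu [t [lt gt]]]].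
- split=> /=; [exact: np1|exact: sg1 sC|exists (fun=> 0); split].
    by rewrite subrr; apply: lead0.
  by move=> B _; rewrite gr_cls1 big1.
- split=> /=; [exact: npM|exact: (sgM sC)|exists (fun j => t j + t' j); split].
    rewrite up_sub1M; apply: lead_ext (leadD pr i0 m0 lt lt') => w wm.
    rewrite [RHS]nsDE (@ord_geM _ m m _ _ Cu Cv) ?addr0 // wm.
    by rewrite -[X in (X < _)%N]addn0 ltn_add2l.
  by move=> B mB; rewrite gr_clsM // (gt B) // (ht B) // big_split.
- split=> /=; [exact: npV|exact: (sgV sC)|exists (fun j => - t j); split].
    rewrite up_sub1V; apply: lead_ext (leadN pr i0 m0 lt) => w wm.
    rewrite (mulr_sub1 _ (upval u^-1%g)) [RHS]nsDE.
    rewrite (@ord_geM _ m m _ _ (ord_geN Cu) (sgV sC Cu)) ?add0r // wm.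
    by rewrite -[X in (X < _)%N]addn0 ltn_add2l.
  by move=> B mB; rewrite gr_clsV // (gt B) // sumrN.
Qed.

Lemma lie_chainP : is_chain (fun m => lie_chain (maxn m 1)).
Proof.
apply: chain_of_pos => [m m0|m m0 [g u] [/= Sg Cu _]|m n [g u] [h v] m0 n0].
- exact: lie_chain_sg.
- split=> /=; [|exact: ord_ge_le (leqnSn m) Cu|exists (fun=> 0); split].
    by apply: series_le Sg; rewrite leq_mul2r leqnSn orbT.
    by apply: lead_ext (lead0 S i x y m) => w wm; rewrite ns0E Cu // wm.
  move=> B _; rewrite big1 // gr_cls_eq0 //; apply: series_le Sg.
  by rewrite mulSn -[X in (X < _)%N]add0n ltn_add2r.
move=> [/= Sg Cu [t [lt gt]]] [/= Sh Cv [t' [lt' ht]]].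
have eMN : ((m + n) * i = m * i + n * i)%N by rewrite mulnDl.
have mn0 : (0 < (m + n) * i)%N by rewrite muln_gt0 addn_gt0 m0.
have Cuv : ord_ge (m + n) ((upval u - 1) * (upval v - 1) - (upval v - 1) * (upval u - 1)).
  by apply: ord_geD; [|apply: ord_geN; rewrite addnC]; apply: ord_geM.
split=> /=.
- by rewrite eMN; apply: series_comm.
- by rewrite /congr_sub /= up_sub1C; apply: ord_geM0.
exists (fun j => \sum_(k < j.+1) gbr ((m + n) * i) (t k) (t' (j - k)%N)); split.
  apply: lead_ext (lead_comm pr i0 Sx Sy m0 n0 Cu Cv lt lt') => w wmn.
  rewrite up_sub1C (mulr_sub1 _ (upval (v * u)^-1%g)) [RHS]nsDE.
  have C1 : @congr_sub 'F_p 1 (v * u)^-1%g.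
    apply: (sgV (@congr_sub_sg 'F_p _)); apply: (sgM (@congr_sub_sg 'F_p _));
    by apply: ord_ge_le; last by [apply: Cv|apply: Cu].
  by rewrite (@ord_geM _ (m + n) 1 _ _ Cuv C1) ?add0r // wmn addn1.
move=> B mnB; rewrite -(gbrE eMN Sg Sh) (gt B) ?(ht B); first last.
- by apply: leq_ltn_trans mnB; rewrite leq_addr.
- by apply: leq_ltn_trans mnB; rewrite leq_addl.
rewrite -(sum_triangle (a := fun j k => gbr ((m + n) * i) (t j) (t' k))); last first.
  move=> j k Bjk; case: (ltnP m j) => [/(lead_big lt)->|jm]; first exact: gbr0l eMN mn0 _.
  rewrite (lead_big lt') ?(gbr0r eMN) // ltnNge; apply: contraL Bjk => kn.
  by rewrite -ltnNge (leq_ltn_trans _ mnB) // leq_add.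
rewrite (gbr_suml eMN) //; apply: eq_bigr => j _.
by rewrite (gbr_sumr eMN).
Qed.

Lemma lie_chain_letter (b : bool) : lie_chain 1 (ltr x y b, magnus_gen 'F_p b).
Proof.
have E : upval (magnus_gen 'F_p b) - 1 = letter 'F_p b by rewrite /upval /= addrC addKr.
have e1 n : (1 * i + n = i + n)%N by rewrite mul1n.
have ii : (1 * i = i)%N by rewrite mul1n.
split=> /=; first by rewrite mul1n; apply: ltr_in.
  by rewrite /congr_sub /= E; apply: ord_letter.
have lb c : letter 'F_p b [:: c] = (c == b)%:R by rewrite /letter eqseq_cons andbT.
exists (fun j : nat => if j == b then gcl (1 * i) (ltr x y b) else 0); split; last first.
  move=> B B1; have bB : (b < B)%N by apply: leq_ltn_trans B1; apply: leq_b1.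
  by rewrite -big_mkcond (big_pred1 (Ordinal bB)).
rewrite E; split=> // [j n N l n0 eN|j|j].
- have N0 : (0 < N)%N by rewrite eN addn_gt0 n0 orbT.
  case: eqP => [->|jb].
    rewrite (act_letter Sx Sy) ?eN ?e1 // lb eqxx mulr1n.
    by case: b {E lb}; rewrite /= /gbr /gr_cls ii.
  rewrite (gbr0l eN) // -[RHS](wsum0 _ 1); apply: eq_wsum => -[|c [|]] // _.
  rewrite /part lb; case: eqP => // cj; case: eqP => // cb.
  by case: jb; rewrite -cj cb /= addn0.
- rewrite /der /= /part !lb /dw /=; case: b {E lb} => /=; case: j => [|[|j]] //=;
  by rewrite ?gr_cls1 ?mul0rn ?mulr0n ?addr0 ?mulr1n.
- by case: b {E lb} => /=; case: j => [|[|j]].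
Qed.

End LieChain.

(** * Lazard's formula for p-th powers *)

Lemma pair_expg (G1 G2 : groupType) (g : G1) (u : G2) n :
  ((g, u) ^+ n = (g ^+ n, u ^+ n))%g.
Proof. by elim: n => // n IHn; rewrite !expgS IHn. Qed.

Section Jacobson.
Variables (p : nat) (pr : prime p) (G : groupType) (S : npSeries p G).
Local Notation gcl := (gr_cls S).
Local Notation grc := (gr_comp S).
Local Notation FS := (ncseries 'F_p).

Lemma mul1D_lead m (a b : FS) : (0 < m)%N -> ord_ge m a -> ord_ge m b ->
  exists2 c, ord_ge m c & (1 + a) * (1 + b) = 1 + c /\
    forall w, size w = m -> c w = a w + b w.
Proof.
move=> m0 am bm; exists (a + b + a * b); last split.
- by apply: ord_geD; [apply: ord_geD | apply: ord_geM0].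
- by rewrite -mul1D_sub1 addrCA subrr addr0.
move=> w wm; rewrite !nsDE (ord_geM am bm) ?addr0 // wm.
by rewrite -[X in (X < _)%N]addn0 ltn_add2l.
Qed.

(** In characteristic p the formula reads
    (1 + X^p) (1 + Y^p) = (1 + (X + Y + XY)^p) (1 + order 2p) c,
    and every word of length p has coefficient 1 in (X + Y)^p. *)
Lemma hall_petrescu_coef (z c : unit_pair FS) :
  powsub p (@congr_sub 'F_p 2) z -> congr_sub p c ->
  (magnus_gen 'F_p true ^+ p * magnus_gen 'F_p false ^+ p
    = (magnus_gen 'F_p true * magnus_gen 'F_p false) ^+ p * z * c)%g ->
  forall w, size w = p -> (0 < count id w < p)%N -> (upval c - 1) w = -1.
Proof.
have p0 := prime_gt0 pr; set f0 := upval c - 1; set g0 := upval z - 1.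
have [ec ez] : upval c = 1 + f0 /\ upval z = 1 + g0 by rewrite ![1 + _]addrC !subrK.
move=> Zz Cc /(congr1 (@upval _)).
rewrite !upvalM !upvalX !upvalM.
have -> b : upval (magnus_gen 'F_p b) = 1 + letter 'F_p b by [].
rewrite !ncseries_frobenius //.
set X := letter _ true; set Y := letter _ false.
have [X1 Y1] : ord_ge 1 X /\ ord_ge 1 Y by split; apply: ord_letter.
have Xp (f : FS) : ord_ge 1 f -> ord_ge p (f ^+ p).
  by move=> f1; rewrite -[p in ord_ge p]muln1; apply: ord_geX.
have [e e1 [-> eE]] := mul1D_lead (ltn0Sn 0) X1 Y1.
rewrite ncseries_frobenius // ec ez.
have [a ap [-> aE]] := mul1D_lead p0 (Xp _ X1) (Xp _ Y1).
have zp : ord_ge p.+1 g0.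
  have : congr_sub p.+1 z; last by [].
  apply: gen_min Zz => [|_ [u u2 <-]]; first exact: congr_sub_sg.
  rewrite /congr_sub /= upvalX -[upval u](subrK 1) (addrC _ 1) ncseries_frobenius // addrC addKr.
  apply: ord_ge_le (ord_geX (n := p) u2).
  by rewrite muln2 -addnn -addn1 leq_add2l.
have [d dp [-> dE]] := mul1D_lead p0 (Xp _ e1) (ord_ge_le (leqnSn p) zp).
have [f fp [-> fE]] := mul1D_lead p0 dp Cc.
move=> /addrI af w wp /andP[w0 wlt].
have : a w = f w by rewrite af.
rewrite aE // fE // dE // zp ?wp // addr0 => E.
have -> : f0 w = (X ^+ p) w + (Y ^+ p) w - (e ^+ p) w.
  by rewrite E addrAC subrr add0r.
rewrite !exp_lead // [X in _ - X]big1_seq => [|b _]; last first.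
  by rewrite eE // /X /Y /letter; case: b; rewrite ?addr0 ?add0r.
have has_letter b : b \in w -> \prod_(c0 <- w) letter 'F_p (~~ b) [:: c0] = 0.
  by move=> bw; apply/eqP; rewrite prodf_seq_eq0; apply/hasP; exists b => //; case: b {bw}.
rewrite (has_letter false) ?(has_letter true) ?addr0 ?add0r //.
- by move: w0; rewrite -has_count => /hasP[[]].
- apply: contraLR wlt => nf; rewrite -leqNgt -[leqLHS]wp leq_eqVlt eq_sym -all_count.
  by apply/orP; left; apply/allP => -[] //= fw; rewrite fw in nf.
Qed.

Lemma regradeE m n g : m = n -> S m g ->
  regrade (L := gr S) n (gcl m g : gr S m) = gcl n g.
Proof. by move=> -> _; rewrite /regrade; case: eqP => // e; rewrite (eq_axiomK e). Qed.

Section Formula.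
Variables (i : nat) (i0 : (0 < i)%N) (x y : G) (Sx : S i x) (Sy : S i y).

Lemma adwordE w : adword (L := gr S) (gcl i x : gr S i) (gcl i y : gr S i) w
  = gcl ((size w).+1 * i) (adw x y w x).
Proof.
elim: w => [|b w IHw] /=; first by rewrite regradeE // mul1n.
have Sw : S ((size w).+1 * i)%N (adw x y w x) by rewrite mulSnr; apply: adw_in.
by rewrite IHw -[RHS](gr_brE (ltr_in Sx Sy b) Sw); case: b.
Qed.

Lemma jacobson_coefE j :
  jacobson_coef p j (gcl i x : gr S i) (gcl i y : gr S i)
  = wsum p.-1 (fun w => if count id w == j.-1 then gcl (p * i) (adw x y w x) else 0).
Proof.
rewrite wsum_tuple -big_mkcond; apply: eq_bigr => w _.
have ew : ((size w).+1 * i = p * i)%N by rewrite size_tuple prednK // prime_gt0.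
by rewrite adwordE regradeE // mulSnr; apply: adw_in.
Qed.

(** Lazard: the p-th power induces a map on the graded ring that satisfies
    Jacobson's formula. The Hall-Petrescu formula is applied in the product of
    G and the Magnus group to (x, 1 + X) and (y, 1 + Y). The factors that are
    p-th powers lie too deep to matter, and the last factor c has a class
    t_0 + ... + t_p with t_0 = t_p = 0. For 0 < j < p the coefficient of c at
    each word of degree j in X is -1, so applying the derivation gives
    j t_j = - sum of ad(w)(x) over the words w x of degree j, which is minus
    the j-th coefficient in Jacobson's formula. *)
Theorem lazard_formula :
  gcl (p * i) ((x * y) ^+ p)%g
  = gcl (p * i) (x ^+ p)%g + gcl (p * i) (y ^+ p)%g
    + jacobson p (gcl i x : gr S i) (gcl i y : gr S i).
Proof.
have p0 := prime_gt0 pr; have p1 := prime_gt1 pr.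
have N0 : (0 < p * i)%N by rewrite muln_gt0 p0.
have [[z1 z2] [[c1 c2] [Zz]]] := hall_petrescu (lie_chainP pr i0 Sx Sy) pr
  (lie_chain_letter Sx Sy true) (lie_chain_letter Sx Sy false).
rewrite (maxn_idPl p0) => -[/= Sc Cc [t [lt ct]]] E.
have E1 : (x ^+ p * y ^+ p = (x * y) ^+ p * z1 * c1)%g.
  have := congr1 (fst \o id) E; rewrite /=.
  by rewrite !pair_expg.
have E2 : (magnus_gen 'F_p true ^+ p * magnus_gen 'F_p false ^+ p
    = (magnus_gen 'F_p true * magnus_gen 'F_p false) ^+ p * z2 * c2)%g.
  have := congr1 (snd \o id) E; rewrite /=.
  by rewrite !pair_expg.
have [Sz1 Zz2] : S (p * i).+1 z1 /\ powsub p (@congr_sub 'F_p 2) z2.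
  pose A := [set gu : G * unit_pair FS | S (p * i).+1 gu.1 /\ powsub p (@congr_sub 'F_p 2) gu.2].
  have : A (z1, z2); last by [].
  apply: gen_min Zz => [|_ [[g u] [/= Sg Cu _] <-]].
    have sP : is_subgroup (powsub p (@congr_sub 'F_p 2)) by apply: genP.
    split=> [|[g u] [h v] [/= Sg Pu] [/= Sh Pv]|[g u] [/= Sg Pu]]; split=> /=.
    - exact: np1.
    - exact: sg1 sP.
    - exact: npM.
    - exact: (sgM sP).
    - exact: npV.
    - exact: (sgV sP).
  rewrite pair_expg; split=> /=; last by apply: gen_sub; exists u.
  by apply: series_le (np_pow Sg); rewrite mul2n -addnn mulnDr -addn1 leq_add2l.
have f1 := hall_petrescu_coef Zz2 Cc E2.
(* The first components: only the class of c1 survives modulo S (p i + 1). *)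
have Sxy : S i (x * y)%g by apply: npM.
have := congr1 (gcl (p * i)) E1.
have [Sxp Syp Sxyp] := And3 (np_pow Sx) (np_pow Sy) (np_pow Sxy).
have Sz : S (p * i)%N z1 by apply: (filt_desc (np_filt S)).
rewrite !gr_clsM ?(gr_cls_eq0 Sz1) ?addr0 //; last exact: npM.
move=> ->; rewrite -addrA -[LHS]addr0; congr (_ + _); apply/esym/eqP; rewrite addr_eq0.
rewrite (ct p.+1) // -(big_mkord xpredT t) big_nat_recr // big_ltn //=.
have [-> ->] := lead_ends lt p1; rewrite add0r addr0 /jacobson -sumrN.
apply/eqP/eq_big_nat => j /andP[j0 jp].
(* The derivation determines j t_j, and j is invertible modulo p. *)
have tors := gr_tors pr (S := S) N0.
have jn0 : (j%:R : 'F_p) != 0.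
  by rewrite -(dvdn_pcharf (pchar_Fp pr)) gtnNdvd.
have -> : t j = t j *+ j *+ ((j%:R : 'F_p)^-1 : 'F_p).
  by rewrite -(mulrFp_nat pr tors (t j) j) -(mulrFpM pr tors) mulVf.
rewrite -(lead_der lt) -mulNrn; congr (_ *+ _).
rewrite jacobson_coefE /der -[X in wsum X](prednK p0) wsum_rcons.
rewrite [RHS](wsum_morph _ _ (h := fun z : grc (p * i) => - z)); last by move=> u v; apply: opprD.
apply: eq_wsum => w wp; rewrite !dw_rcons adw1 gr_cls1 mul0rn addr0.
have sw : size (rcons w true) = p by rewrite size_rcons wp prednK.
have cw : count id (rcons w true) = (count id w).+1 by rewrite -cats1 count_cat addn1.
rewrite /part cw -{1}(prednK j0) eqSS; case: eqP => cj; last by rewrite mulr0n oppr0.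
by rewrite f1 ?cw ?cj ?prednK ?j0 //; apply: (mulrFpN pr tors _ 1).
Qed.

End Formula.
End Jacobson.

Local Close Scope ring_scope.

Section PowerMap.
Variables (p : nat) (pr : prime p) (G : groupType) (S : npSeries p G).
Local Notation gcl := (gr_cls S).
Local Notation grc := (gr_comp S).

Lemma gr_triv n (x y : grc n) : n = 0%N -> x = y.
Proof. by move=> n0; move: n0 x y => ->; apply: gr_triv0. Qed.

(** Lazard's formula with a first element of class 0: each term of Jacobson's
    sum has that class as its innermost entry. *)
Lemma pow_congr i c g : S i.+1 c -> S i g ->
  gcl (p * i) ((c * g) ^+ p) = gcl (p * i) (g ^+ p).
Proof.
case: i => [|i] Sc Sg; first by apply: gr_triv; rewrite muln0.
have Sc' : S i.+1 c by apply: filt_desc (np_filt S) _ _ Sc.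
have p0 := prime_gt0 pr.
rewrite (lazard_formula pr (ltn0Sn i) Sc' Sg) (_ : jacobson _ _ _ = 0)%R.
  rewrite addr0 (_ : gcl _ (c ^+ p) = 0)%R ?add0r // gr_cls_eq0 //.
  by apply: series_le (np_pow Sc); rewrite ltn_pmul2l.
rewrite /jacobson big1_seq // => j _.
rewrite jacobson_coefE // -[in RHS](mul0rn _ ((j%:R : 'F_p)^-1 : 'F_p)%R); congr (_ *+ _)%R.
rewrite -[RHS](wsum0 _ p.-1); apply: eq_wsum => w wp; case: ifP => // _.
have e : ((p * i.+1).+1 = size w * i.+1 + i.+2)%N.
  by rewrite wp addnS -mulSnr prednK.
by rewrite gr_cls_eq0 // e; apply: adw_in.
Qed.

Lemma gr_powE i g : S i g -> rlie_pow (gcl i g : gr S i) = gcl (p * i) (g ^+ p).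
Proof.
move=> Sg; rewrite [LHS]/=; have := @rep_cls _ (gr_pair S i) g Sg.
rewrite /= => Sr; rewrite -[X in X ^+ p](mulgVK g).
exact: pow_congr.
Qed.

Lemma gr_powD i (x y : gr S i) :
  rlie_pow (x + y)%R = (rlie_pow x + rlie_pow y + jacobson p x y)%R.
Proof.
case: (posnP i) => [i0|i0]; first by apply: gr_triv; rewrite i0 muln0.
case: (grP x) => g Sg; case: (grP y) => h Sh.
rewrite -gr_clsM // !gr_powE //; last exact: npM.
exact: lazard_formula.
Qed.

End PowerMap.

Section Morphism.
Local Open Scope ring_scope.
Variables (L M : grLie) (phi : forall i, L i -> M i).
Hypothesis phiD : forall i, {morph phi (i := i) : x y / x + y}.
Hypothesis phi_br : forall i j (x : L i) (y : L j),
  phi (lie_br x y) = lie_br (phi x) (phi y).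

Lemma morph_phi0 i : phi (0 : L i) = 0.
Proof. by apply: (addrI (phi 0)); rewrite -phiD !addr0. Qed.

Lemma morph_regrade m n (x : L m) : phi (regrade n x) = regrade n (phi x).
Proof.
rewrite /regrade; case: eqP => [e|_]; last exact: morph_phi0.
by move: x; case: n / e.
Qed.

Lemma morph_adword i (x y : L i) w : phi (adword x y w) = adword (phi x) (phi y) w.
Proof.
elim: w => [|b w IHw] /=; first exact: morph_regrade.
by rewrite phi_br IHw; case: b.
Qed.

Lemma morph_jacobson p i (x y : L i) :
  phi (jacobson p x y) = jacobson p (phi x) (phi y).
Proof.
have phi_sum I (r : seq I) (P : pred I) n (F : I -> L n) :
    phi (\sum_(k <- r | P k) F k) = \sum_(k <- r | P k) phi (F k).
  by apply: (big_morph (@phi n)) => [u v|]; rewrite ?phiD ?morph_phi0.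
have phiMn n (z : L n) k : phi (z *+ k) = phi z *+ k.
  by elim: k => [|k IHk]; rewrite ?mulr0n ?morph_phi0 // !mulrS phiD IHk.
rewrite phi_sum; apply: eq_bigr => j _; rewrite phiMn phi_sum; congr (_ *+ _).
by apply: eq_bigr => w _; rewrite morph_regrade morph_adword.
Qed.

End Morphism.

Section Series.
Variable p : nat.

Lemma Npseries_intro (G : groupType) (T : nat -> set G) :
  T 0%N = setT -> T 1%N = setT -> (forall i, is_subgroup (T i)) ->
  (forall i, T i.+1 `<=` T i) ->
  (forall i j x y, T i x -> T j y -> T (i + j)%N (comm x y)) ->
  (forall i x, T i x -> T (p * i)%N (x ^+ p)) -> is_Npseries p T.
Proof.
move=> T0 T1 sT dT cT pT; split; first split=> // i j _ _.
  by apply: gen_min => // _ [x [y [Tx Ty ->]]]; apply: cT.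
by move=> i _; apply: gen_min => // _ [x Tx <-]; apply: pT.
Qed.

Lemma gammap_min (G : groupType) (T : npSeries p G) n : gammap p G n `<=` T n.
Proof. by move=> x; apply; apply: npseriesP. Qed.

Lemma Npseries_preim (G G' : groupType) (f : G -> G') (T : npSeries p G') :
  {morph f : x y / x * y} -> is_Npseries p (fun n => f @^-1` T n).
Proof.
move=> fM; have f1 : f 1 = 1 by apply: (mulgI (f 1)); rewrite -fM !mulg1.
have fV x : f x^-1 = (f x)^-1 by apply: (mulgI (f x)); rewrite -fM !mulgV f1.
have fX x n : f (x ^+ n) = f x ^+ n by elim: n => // n IHn; rewrite !expgS fM IHn.
apply: Npseries_intro => [||i|i x|i j x y Tx Ty|i x Tx].
- by apply/seteqP; split=> // x _; apply: np0.
- by apply/seteqP; split=> // x _; rewrite /preimage /= (filt1 (np_filt T)).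
- split=> [|x y|x]; rewrite /preimage /= ?f1 ?fM ?fV; [exact: np1|exact: npM|exact: npV].
- exact: (filt_desc (np_filt T)).
- by rewrite /preimage /= /comm !fM !fV; apply: series_comm.
- by rewrite /preimage /= fX; apply: np_pow.
Qed.

End Series.

(** * The semidirect product and series stabilized by K *)

Section Semidirect.
Variables (K H : groupType) (a : autAction K H).
Local Notation SD := (sdprod a).
Local Notation sdl := (@sdl K H a).
Local Notation sdr := (@sdr K H a).

Lemma sd_fst (x y : SD) : (x * y).1 = x.1 * a x.2 y.1. Proof. by []. Qed.
Lemma sd_snd (x y : SD) : (x * y).2 = x.2 * y.2. Proof. by []. Qed.
Lemma sdlM : {morph sdl : h h' / h * h'}.
Proof. by move=> h h'; rewrite /Defs.sdl; congr pair; rewrite /= ?aact1 ?mulg1. Qed.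

Lemma sdrM : {morph sdr : k l / k * l}.
Proof. by move=> k l; rewrite /Defs.sdr; congr pair; rewrite /= ?aact_1r ?mulg1. Qed.

Lemma sdlX h n : sdl (h ^+ n) = sdl h ^+ n.
Proof. by elim: n => // n IHn; rewrite !expgS sdlM IHn. Qed.

Lemma sdrX k n : sdr (k ^+ n) = sdr k ^+ n.
Proof. by elim: n => // n IHn; rewrite !expgS sdrM IHn. Qed.

Lemma sdlV h : sdl h^-1 = (sdl h)^-1.
Proof. by apply: (mulgI (sdl h)); rewrite -sdlM !mulgV. Qed.

Lemma sdrV k : sdr k^-1 = (sdr k)^-1.
Proof. by apply: (mulgI (sdr k)); rewrite -sdrM !mulgV. Qed.

Lemma sd_split (x : SD) : x = sdl x.1 * sdr x.2.
Proof. by case: x => h k; congr pair; rewrite /= ?aact1 ?mulg1 ?mul1g. Qed.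

Lemma sd_sndl (x : SD) : x.2 = 1 -> x = sdl x.1.
Proof. by case: x => h k /= ->. Qed.

Lemma aactV k h : a k h^-1 = (a k h)^-1.
Proof. by apply: (mulgI (a k h)); rewrite -aactMr !mulgV aact_1r. Qed.

Lemma aactX k h n : a k (h ^+ n) = a k h ^+ n.
Proof. by elim: n => [|n IHn]; rewrite ?aact_1r // !expgS aactMr IHn. Qed.

Lemma aactVK k h : a k (a k^-1 h) = h.
Proof. by rewrite -aactM mulgV aact1. Qed.

Lemma comm_sdrl k h : comm (sdr k) (sdl h) = sdl (a k h / h).
Proof.
apply: (mulIg (sdl h * sdr k)); have -> : comm (sdr k) (sdl h) * (sdl h * sdr k) = sdr k * sdl h.
  by group_simp.
by congr pair; rewrite /= ?aact_1r ?aact1 ?mulg1 ?mul1g ?mulgVK.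
Qed.

Lemma comm_sdl h h' : comm (sdl h) (sdl h') = sdl (comm h h').
Proof. by rewrite /comm !sdlM !sdlV. Qed.

Lemma comm_sdr k l : comm (sdr k) (sdr l) = sdr (comm k l).
Proof. by rewrite /comm !sdrM !sdrV. Qed.

(** The commutator is the solution c of c (y x) = x y. *)
Lemma sd_comm (x y : SD) : comm x y =
  (x.1 * a x.2 y.1 * (a (comm x.2 y.2) (y.1 * a y.2 x.1))^-1, comm x.2 y.2).
Proof.
apply: (mulIg (y * x)); have -> : comm x y * (y * x) = x * y by group_simp.
by congr pair; rewrite /= ?mulgVK //; group_simp.
Qed.

Section Stable.
Variables (p : nat) (pr : prime p) (A : npSeries p H).
Hypothesis shift : forall i k h, A i h -> A i.+1 (a k h / h).

Lemma aact_stable i k h : A i h -> A i (a k h).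
Proof.
move=> Ah; rewrite -(mulgVK h (a k h)); apply: npM => //.
by apply: (filt_desc (np_filt A)); apply: shift.
Qed.

(** Kaloujnine's series: the automorphisms that stabilize the factors of the
    series A with a shift by j. *)
Definition stabK (j : nat) : set K :=
  [set k | forall i h, A i h -> A (i + j)%N (a k h / h)].

Lemma stabK_sg j : is_subgroup (stabK j).
Proof.
split=> [i h _|k l dk dl i h Ah|k dk i h Ah]; first by rewrite aact1 mulgV; apply: np1.
- have -> : a (k * l) h / h = a k (a l h / h) * (a k h / h).
    by rewrite aactM aactMr aactV; group_simp.
  by apply: npM; [apply/aact_stable/dl | apply: dk].
- have := dk _ _ (aact_stable k^-1 Ah); rewrite aactVK => /npV.
  by rewrite invgF.
Qed.

(** Compare k l and l k on h' = (l k)^-1 h. If c and d are the displacements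
    of h' under k and l, the images are d c h' and c d h' up to terms of depth
    n + i + j, and [d, c] has that depth too. *)
Lemma stabK_comm i j k l : stabK i k -> stabK j l -> stabK (i + j)%N (comm k l).
Proof.
move=> dk dl n h Ah; pose h' := a (l * k)^-1 h.
have Ah' : A n h' by apply: aact_stable.
pose d := a l h' / h'; pose c := a k h' / h'.
have Ad : A (n + j)%N d by apply: dl.
have Ac : A (n + i)%N c by apply: dk.
have Eh : h = a l (a k h') by rewrite -aactM aactVK.
have Ec : a (comm k l) h = a k (a l h').
  by rewrite Eh -!aactM; congr (a _ _); group_simp.
have ld : a l h' = d * h' by rewrite /d mulgVK.
have kc : a k h' = c * h' by rewrite /c mulgVK.
have -> : a (comm k l) h / h = (a k d / d) * comm d c * (a l c / c)^-1.
  rewrite Ec [in X in _ / X]Eh ld kc !aactMr ld kc; group_simp; congr (_ * _).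
apply: npM; first apply: npM.
- by rewrite addnA addnAC; apply: dk.
- apply: series_le (series_comm Ad Ac).
  by rewrite addnACA (addnC j) leq_add2r leq_addr.
- by apply: npV; rewrite addnA; apply: dl.
Qed.

End Stable.
End Semidirect.

Section Semidirect2.
Variables (K H : groupType) (a : autAction K H).
Local Notation SD := (sdprod a).
Local Notation sdl := (@sdl K H a).
Local Notation sdr := (@sdr K H a).

Section Stable.
Variables (p : nat) (pr : prime p) (A : npSeries p H).
Hypothesis shift : forall i k h, A i h -> A i.+1 (a k h / h).

Definition level (n : nat) : set SD := [set u | A n u.1 /\ u.2 = 1].

Lemma level_sg n : is_subgroup (level n).
Proof.
split=> [|[h k] [h' k'] [/= Ah ->] [/= Ah' ->]|[h k] [/= Ah ->]]; split=> //=.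
- exact: np1.
- by rewrite aact1; apply: npM.
- by rewrite mulg1.
- by rewrite invg1 aact1; apply: npV.
- by rewrite invg1.
Qed.

Section HallPetrescu.
Variables (i j : nat) (C : set K).
Hypotheses (sC : is_subgroup C) (abC : forall k l, C k -> C l -> k * l = l * k).
Hypothesis stabC : C `<=` stabK a A j.

(** Only the first term has a component in K. As C is commutative the
    commutators lie in H, and as C has depth j they gain a weight j each time
    an element of C enters. *)
Definition sd_chain (m : nat) : set SD :=
  [set u | [/\ A (i + m * j)%N u.1, C u.2 & (1 < m)%N -> u.2 = 1]].

Lemma sd_chainP : is_chain (fun m => sd_chain (maxn m 1)).
Proof.
apply: chain_of_pos => [m m0|m m0 [h k] [/= Ah Ck k1]|m n [b k] [c l] m0 n0].
- split=> [|[h k] [h' k'] [/= Ah Ck k1] [/= Ah' Ck' k1']|[h k] [/= Ah Ck k1]].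
  + by split=> //=; [apply: np1 | apply: sg1 sC].
  + split=> /=; [by apply: npM => //; apply: aact_stable|exact: (sgM sC)|].
    by move=> m1; rewrite k1 // k1' // mulg1.
  + split=> /=; [by apply: aact_stable => //; apply: npV|exact: (sgV sC)|].
    by move=> m1; rewrite k1 // invg1.
- have k1' : k = 1 by apply: k1; rewrite ltnS.
  split=> //=; apply: series_le Ah.
  by rewrite leq_add2l leq_mul2r leqnSn orbT.
move=> [/= Ab Ck k1] [/= Ac Cl l1].
have Ckl : comm k l = 1 by rewrite /comm (abC Ck Cl); group_simp.
rewrite sd_comm /= Ckl aact1; split=> //=; last exact: sg1 sC.
have mono q r e : (e <= r)%N -> A (i + q * j + r * j)%N `<=` A (i + (q + e) * j)%N.
  by move=> er; apply: series_le; rewrite mulnDl addnA leq_add2l leq_mul2r er orbT.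
have Akc : A (i + (m + n) * j)%N (a k c / c).
  case: (ltnP 1 m) => [/k1->|m1]; first by rewrite aact1 mulgV; apply: np1.
  by rewrite (addnC m); apply: (mono _ _ _ m1); rewrite mul1n; apply: stabC.
have Alb : A (i + (m + n) * j)%N (a l b / b).
  case: (ltnP 1 n) => [/l1->|n1]; first by rewrite aact1 mulgV; apply: np1.
  by apply: (mono _ _ _ n1); rewrite mul1n; apply: stabC.
have -> : b * a k c * (c * a l b)^-1
    = (b * (a k c / c) * b^-1) * comm b c * (c * (a l b / b)^-1 * c^-1) by group_simp.
apply: npM; [apply: npM|]; first exact: npJ.
  apply: series_le (series_comm Ab Ac).
  by rewrite mulnDl addnACA leq_add2r leq_addr.
by apply/npJ/npV.
Qed.

(** The p-th powers of the corrections have weight at least p (i + 2 j), which is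
    at least i + p j. *)
Lemma sd_hall_petrescu (x y : SD) : sd_chain 1 x -> sd_chain 1 y ->
  exists2 w, level (i + p * j) w & x ^+ p * y ^+ p = (x * y) ^+ p * w.
Proof.
move=> Rx Ry; have [z [c [Zz Rc E]]] := hall_petrescu sd_chainP pr Rx Ry.
exists (z * c); last by rewrite mulgA.
apply: (sgM (level_sg _)); last first.
  by move: Rc; rewrite (maxn_idPl (prime_gt0 pr)) => -[Ac _ c1]; split=> //; apply/c1/prime_gt1.
apply: gen_min Zz => [|_ [u [/= Au _ u1] <-]]; first exact: level_sg.
rewrite (sd_sndl (u1 isT)) -sdlX; split=> //=.
apply: series_le (np_pow Au); rewrite mulnDr leq_add ?leq_pmull ?prime_gt0 //.
by rewrite leq_mul2l leq_pmull ?orbT.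
Qed.

End HallPetrescu.

(** The double centralizer of k, a commutative subgroup that contains k: it
    plays the part of the cyclic group generated by k. *)
Definition bicomm (j : nat) (k : K) : set K :=
  [set l | stabK a A j l /\ forall z, z * k = k * z -> z * l = l * z].

Lemma bicomm_sg j k : is_subgroup (bicomm j k).
Proof.
have sD := stabK_sg shift j.
split=> [|l l' [dl cl] [dl' cl']|l [dl cl]]; split.
- exact: sg1 sD.
- by move=> z _; rewrite mul1g mulg1.
- exact: (sgM sD).
- by move=> z zk; apply: commuteM; [apply: cl | apply: cl'].
- exact: (sgV sD).
- by move=> z /cl zl; apply: commuteV.
Qed.

Lemma bicomm_abelian j k l l' : bicomm j k l -> bicomm j k l' -> l * l' = l' * l.
Proof. by move=> [_ cl] [_ cl']; apply: cl'; apply/esym; apply: cl. Qed.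

Lemma bicomm_self j k : stabK a A j k -> bicomm j k k.
Proof. by []. Qed.

Lemma bicomm_stabK j k : bicomm j k `<=` stabK a A j.
Proof. by move=> l []. Qed.

(** The commutator of k^p with h is k^p (h k^-1 h^-1)^p; the product of k and
    h k^-1 h^-1 is the commutator of k with h, so Hall-Petrescu reduces the
    claim to the p-th power of this commutator. *)
Lemma stabK_pow j k : stabK a A j k -> stabK a A (p * j) (k ^+ p).
Proof.
move=> dk i h Ah.
have Ck := bicomm_self dk.
have sC := bicomm_sg j k; have abC := @bicomm_abelian j k; have dC := @bicomm_stabK j k.
pose y : SD := sdl h * sdr k^-1 * (sdl h)^-1.
have y1 : y.1 = h * a k^-1 h^-1.
  by rewrite /y -sdlV !sd_fst !sd_snd /= aact1 mulg1 mul1g.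
have y2 : y.2 = k^-1 by rewrite /y !sd_snd /= invg1 mulg1 mul1g.
have Ry : sd_chain i j (bicomm j k) 1 y.
  split=> //; rewrite ?y1 ?y2 ?mul1n; last exact: (sgV sC).
  by rewrite aactV -invgF; apply: npV; apply: (sgV (stabK_sg shift j) dk).
have Rk : sd_chain i j (bicomm j k) 1 (sdr k) by split=> //=; apply: np1.
have [w [Aw w2] E] := sd_hall_petrescu sC abC dC Rk Ry.
have y_exp n : y ^+ n = sdl h * sdr k^-1 ^+ n * (sdl h)^-1.
  elim: n => [|n IHn]; first by rewrite !expg0 mulg1 mulgV.
  by rewrite !expgS IHn /y; group_simp.
have xy : sdr k * y = sdl (a k h / h).
  by rewrite -comm_sdrl /y sdrV; group_simp.
have : sdl (a (k ^+ p) h / h) = sdl ((a k h / h) ^+ p) * w.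
  rewrite -comm_sdrl sdlX -xy -E y_exp sdrX sdrV expVgn.
  by group_simp.
rewrite (sd_sndl w2) -sdlM => -[->]; apply: npM => //.
apply: series_le (np_pow (dk _ _ Ah)).
by rewrite mulnDr leq_add2r leq_pmull ?prime_gt0.
Qed.

Lemma stabK_Npseries : is_Npseries p (stabK a A).
Proof.
apply: Npseries_intro => [||i|i k dk n h Ah|i j k l|i k].
- apply/seteqP; split=> // k _ i h Ah; rewrite addn0.
  by apply: npM; [apply: aact_stable | apply: npV].
- by apply/seteqP; split=> // k _ i h Ah; rewrite addn1; apply: shift.
- exact: stabK_sg.
- by apply: (filt_desc (np_filt A)); rewrite -addnS; apply: dk.
- exact: stabK_comm.
- exact: stabK_pow.
Qed.

Lemma gammap_stabK j k : gammap p K j k -> stabK a A j k.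
Proof. exact: (@gammap_min p K (NpSeries stabK_Npseries)). Qed.

(** For commutators this uses that gamma_j^[p](K) shifts A by j, and for p-th
    powers the Hall-Petrescu formula, since (h k)^p and h^p k^p differ by an
    element of A_(p i). *)
Lemma sdset_Npseries : is_Npseries p (fun n => sdset a (A n) (gammap p K n)).
Proof.
have sU n : is_subgroup (sdset a (A n) (gammap p K n)).
  split=> [|[h k] [h' k'] [/= Ah gk] [/= Ah' gk']|[h k] [/= Ah gk]]; split=> /=.
  - exact: np1.
  - exact: np1 (gammap p K) _.
  - by apply: npM => //; apply: aact_stable.
  - exact: (npM (S := gammap p K) gk gk').
  - by apply: aact_stable => //; apply: npV.
  - exact: (npV (S := gammap p K) gk).
apply: Npseries_intro => // [||i|i j [h k] [h' k'] [/= Ah gk] [/= Ah' gk']|i [h k] [/= Ah gk]].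
- by apply/seteqP; split=> // x _; split; [apply: np0 | apply: (np0 (gammap p K))].
- apply/seteqP; split=> // x _.
  by split; [rewrite (filt1 (np_filt A)) | rewrite (filt1 (np_filt (gammap p K)))].
- by move=> [h k] [/= Ah gk]; split; [apply: (filt_desc (np_filt A)) | apply: (filt_desc (np_filt (gammap p K)))].
- have gq := series_comm (S := gammap p K) gk gk'.
  rewrite sd_comm; split=> //=.
  have dk := gammap_stabK gk Ah'; have dk' := gammap_stabK gk' Ah.
  have dq := gammap_stabK gq (np0 A (h' * a k' h)).
  rewrite add0n in dq; rewrite addnC in dk.
  have -> : h * a k h' * (a (comm k k') (h' * a k' h))^-1
      = (h * (a k h' / h') * h^-1) * comm h h' * (h' * (a k' h / h)^-1 * h'^-1)
        * (a (comm k k') (h' * a k' h) / (h' * a k' h))^-1.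
    by move: (a (comm k k') _) => u; group_simp.
  apply: npM; last exact: npV.
  apply: npM; last by apply/npJ/npV.
  by apply: npM; [apply: npJ | apply: series_comm].
have dk : stabK a A i k by apply: gammap_stabK gk.
have R1 : sd_chain 0 i (bicomm i k) 1 (sdl h).
  by split=> //=; [rewrite mul1n | apply: sg1 (bicomm_sg i k)].
have R2 : sd_chain 0 i (bicomm i k) 1 (sdr k).
  by split=> //=; apply: np1.
have [w [Aw w2]] := sd_hall_petrescu (bicomm_sg i k) (@bicomm_abelian i k) (@bicomm_stabK i k) R1 R2.
rewrite -sdlX -sdrX -(sd_split ((h, k) : SD)) => E.
have -> : ((h, k) : SD) ^+ p = sdl (h ^+ p) * sdr (k ^+ p) * w^-1 by rewrite E mulgK.
apply: (sgM (sU _)); last first.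
  by apply: (sgV (sU _)); split; rewrite ?w2 //; apply: (np1 (gammap p K)).
apply: (sgM (sU _)); split=> /=; first exact: np_pow.
- exact: np1 (gammap p K) _.
- exact: np1.
- exact: (np_pow (S := gammap p K) gk).
Qed.

End Stable.

Section StablePart.
Variables (p : nat) (pr : prime p) (A : npSeries p H).
Hypothesis shift1 : forall k h, A 2 (a k h / h).

(** The elements whose classes in the graded ring are fixed by K. *)
Definition stabH (i : nat) : set H :=
  [set h | A i h /\ forall k, A i.+1 (a k h / h)].

(** Commutators and p-th powers are well defined on the classes of the graded
    ring, hence preserve fixed classes. For p-th powers this is the part of
    Lazard's formula stated in [pow_congr]. *)
Lemma stabH_Npseries : is_Npseries p stabH.
Proof.
have fA := np_filt A.
have desc i h : A i.+1 h -> A i h by apply: (filt_desc fA).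
apply: Npseries_intro => [||i|i h [Ah sh]|i j h l [Ah sh] [Al sl]|i h [Ah sh]].
- by apply/seteqP; split=> // h _; split=> [|k]; rewrite ?(filt1 fA) //; apply: np0.
- by apply/seteqP; split=> // h _; split=> [|k]; rewrite ?(filt1 fA).
- split=> [|h l [Ah sh] [Al sl]|h [Ah sh]].
  + by split=> [|k]; rewrite ?aact_1r ?mulgV; apply: np1.
  + split=> [|k]; first exact: npM.
    have -> : a k (h * l) / (h * l) = (a k h / h) * (h * (a k l / l) * h^-1).
      by rewrite aactMr; group_simp.
    by apply: npM => //; apply: npJ.
  + split=> [|k]; first exact: npV.
    have -> : a k h^-1 / h^-1 = h^-1 * (h * (a k h)^-1) * h^-1^-1.
      by rewrite aactV; group_simp.
    by apply: npJ; rewrite -invgF; apply: npV.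
- by split=> [|k]; apply: desc.
- split=> [|k]; first exact: series_comm.
  have Akh : A i (a k h) by rewrite -(mulgVK h (a k h)); apply: npM => //; apply/desc.
  have Akl : A j (a k l) by rewrite -(mulgVK l (a k l)); apply: npM => //; apply/desc.
  have -> : a k (comm h l) = comm (a k h) (a k l) by rewrite /comm !aactMr !aactV.
  apply/gr_clsP; try exact: series_comm.
  rewrite -!(gbrE erefl) //; congr gbr; exact/gr_clsP.
- split=> [|k]; first exact: np_pow.
  rewrite aactX -(mulgVK h (a k h)); apply/gr_clsP; last exact: pow_congr.
  + by apply/np_pow/npM => //; apply: desc.
  + exact: np_pow.
Qed.

Lemma gammap_stabH i k h : gammap p H i h -> A i.+1 (a k h / h).
Proof. by move=> /(@gammap_min p H (NpSeries stabH_Npseries))[]. Qed.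

End StablePart.
End Semidirect2.

(** * The restricted lower central series of the semidirect product *)

Section Semidirect3.
Variables (p : nat) (pr : prime p) (K H : groupType) (a : autAction K H).
Local Notation SD := (sdprod a).
Local Notation sdl := (@sdl K H a).
Local Notation sdr := (@sdr K H a).

Definition gammaK_closure : npSeries p H := NpSeries (Np_closureP p (gammaK a)).

Lemma gammaK_shift i k h : 0 < i -> gammaK a i h -> gammaK a i.+1 (a k h / h).
Proof.
case: i => // i _ gh; rewrite /gammaK /preimage /= -comm_sdrl.
by apply: gen_sub; exists (sdr k), (sdl h).
Qed.

Lemma gammaK1 : gammaK a 1%N = setT.
Proof. by apply/seteqP; split=> // h _; exists h. Qed.

Lemma gammaK_sub_closure i : 0 < i -> gammaK a i `<=` gammaK_closure i.
Proof. by move=> i0 h gh T [_]; apply. Qed.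

(** The elements whose classes are fixed by K form an N_p-series that contains
    gamma^K, so they exhaust the smallest one. *)
Lemma gammaK_closure_shift i k h : gammaK_closure i h -> gammaK_closure i.+1 (a k h / h).
Proof.
have shift1 l h' : gammaK_closure 2 (a l h' / h').
  by apply: gammaK_sub_closure => //; apply: gammaK_shift; rewrite ?gammaK1.
have sub j : 0 < j -> gammaK a j `<=` stabH a gammaK_closure j.
  move=> j0 h' gh'; split=> [|l]; first exact: gammaK_sub_closure.
  by apply: gammaK_sub_closure => //; apply: gammaK_shift.
by case/(_ _ (conj (stabH_Npseries pr shift1) sub)).
Qed.

(** The commutator of (h, k) with t in T_n is a product of a conjugate of
    (k . t) t^-1 and of [h, t]: the first factor lies in T_(n+1) by hypothesis,
    the second because T is an N-series. *)
Lemma gammaK_min (T : npSeries p H) :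
  (forall i k h, T i h -> T i.+1 (a k h / h)) ->
  forall n, 0 < n -> gammaK a n `<=` T n.
Proof.
move=> shift [//|n] _.
suff S m : iter m (commsub [set: SD]) (range sdl) `<=` @level K H a p T m.+1.
  by move=> h /S[].
elim: m => [|m IHm] /=.
  by move=> _ [h _ <-]; split=> //=; rewrite (filt1 (np_filt T)).
apply: gen_min; first exact: level_sg.
move=> _ [[h k] [x [_ /IHm Lx ->]]].
case: x Lx => t l [/= Tt ->]; have c1 : comm k (1 : K) = 1 by group_simp.
rewrite sd_comm /= c1 !aact1; split=> //=.
have -> : h * a k t * (t * h)^-1 = (h * (a k t / t) * h^-1) * comm h t by group_simp.
apply: npM; first by apply/npJ/shift.
by rewrite -add1n; apply: series_comm => //; rewrite (filt1 (np_filt T)).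
Qed.

Lemma gammap_sdprod n :
  gammap p SD n = sdset a (gammaK_closure n) (gammap p K n).
Proof.
apply/seteqP; split.
  exact: (@gammap_min p SD (NpSeries (sdset_Npseries pr gammaK_closure_shift))).
pose T := gammap p SD; have T1 x : T 1%N x by rewrite (filt1 (np_filt T)).
move=> [h k] [/= Ah gk]; rewrite [(h, k)](sd_split ((h, k) : SD)).
apply: (npM (S := T)).
  case: n Ah {gk} => [|n] Ah; first exact: (np0 T).
  apply: (Ah (fun n => sdl @^-1` T n)); split; first exact: Npseries_preim (@sdlM _ _ a).
  case=> // i _ h' /=; rewrite /preimage /=.
  suff S m : iter m (commsub [set: SD]) (range sdl) `<=` T m.+1 by apply: S.
  elim: m => [|m IHm] //; apply: gen_min; first exact: np_sg.
  move=> _ [x [y [_ /IHm Ty ->]]]; rewrite -add1n; exact: series_comm.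
exact: (@gammap_min p K (NpSeries (Npseries_preim T (@sdrM _ _ a)))).
Qed.

Section Trivial.
Hypothesis trivial : trivial_on_modab a p.

(** By hypothesis K fixes the classes of degree 1, because [H, H] H^p is
    contained in the second term; so it fixes all classes. *)
Lemma gammap_shift i k h : gammap p H i h -> gammap p H i.+1 (a k h / h).
Proof.
apply: gammap_stabH => // {}k {}h.
have p1 := prime_gt1 pr.
have: modab_bot p (a k h / h) by apply/(@clsP _ (modab_pair p H)).
have S1 g : gammap p H 1%N g by rewrite (filt1 (np_filt _)).
apply: gen_min => [|_ [[g [g' ->]]|[g _ <-]]]; first exact: (np_sg (gammap p H)).
  by rewrite -[2]/(1 + 1)%N; apply: (series_comm (S := gammap p H)).
by apply: (series_le _ (np_pow (S1 g))); rewrite muln1.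
Qed.

Lemma gammaK_closure_trivial n : gammaK_closure n = gammap p H n.
Proof.
apply/seteqP; split; last exact: gammap_min.
move=> h; apply; split; first exact: npseriesP.
exact: gammaK_min gammap_shift.
Qed.

Lemma gammap_act i j k h : gammap p K j k -> gammap p H i h ->
  gammap p H (i + j)%N (a k h / h).
Proof. move=> gk gh; exact: (gammap_stabK pr gammap_shift gk gh). Qed.

Lemma gammap_sdprod_trivial n :
  gammap p SD n = sdset a (gammap p H n) (gammap p K n).
Proof. by rewrite gammap_sdprod gammaK_closure_trivial. Qed.

Lemma gammap_compatible : compatible a (gammap p H) (gammap p K).
Proof.
move=> i j _ _; apply: gen_min.
  split=> [|_ _ [h Ah <-] [h' Ah' <-]|_ [h Ah <-]].
  - by exists 1 => //; apply: np1.
  - by exists (h * h'); [apply: npM | rewrite sdlM].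
  - by exists h^-1; [apply: npV | rewrite sdlV].
move=> _ [_ [_ [[k gk <-] [h Ah <-] ->]]]; exists (a k h / h); last by rewrite comm_sdrl.
exact: gammap_act.
Qed.

Local Notation B := (gammap p H).
Local Notation C := (gammap p K).
Local Notation S := (gammap p SD).

(** By [gr_sd_mapE] the components may be read on any representative. *)
Definition gr_sd_map (i : nat) (z : gr S i) : gr_sd a B C i :=
  (gr_cls B i (rep z).1, gr_cls C i (rep z).2).

Lemma gr_cls_act i k h : B i h -> gr_cls B i (a k h) = gr_cls B i h.
Proof.
by move=> Bh; apply/gr_clsP => //; [apply: (aact_stable gammap_shift) | apply: gammap_shift].
Qed.

Lemma gammap_sdprodE i (x : SD) : S i x <-> B i x.1 /\ C i x.2.
Proof. by rewrite gammap_sdprod_trivial. Qed.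

Lemma gr_sd_mapE i (x : SD) : S i x ->
  gr_sd_map (gr_cls S i x) = (gr_cls B i x.1, gr_cls C i x.2).
Proof.
move=> Sx; have := @rep_cls _ (gr_pair S i) x Sx; rewrite /gr_sd_map.
set y := rep _; rewrite [bot _]/= => Syx.
have -> : y = (y / x) * x by rewrite mulgVK.
move: (y / x) Syx => u /gammap_sdprodE[Bu Cu]; have [Bx Cx] := (gammap_sdprodE i x).1 Sx.
have [Bu' Cu'] : B i u.1 /\ C i u.2 by split; apply: (filt_desc (np_filt _)).
rewrite sd_fst sd_snd !gr_clsM //; last exact: (aact_stable gammap_shift).
by rewrite !(gr_cls_eq0 Bu, gr_cls_eq0 Cu) !add0r gr_cls_act.
Qed.

Lemma gr_sd_mapD i : {morph @gr_sd_map i : x y / (x + y)%R}.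
Proof.
move=> z z'; case: (grP z) => x Sx; case: (grP z') => y Sy.
have [Bx Cx] := (gammap_sdprodE i x).1 Sx; have [By Cy] := (gammap_sdprodE i y).1 Sy.
rewrite -gr_clsM // !gr_sd_mapE //; last exact: npM.
rewrite sd_fst sd_snd !gr_clsM //; last exact: (aact_stable gammap_shift).
by rewrite gr_cls_act.
Qed.

Lemma S_sdl i h : B i h -> S i (sdl h).
Proof. by move=> Bh; apply/gammap_sdprodE; split=> //; apply: np1. Qed.

Lemma S_sdr i k : C i k -> S i (sdr k).
Proof. by move=> Ck; apply/gammap_sdprodE; split=> //; apply: np1. Qed.

Lemma gr_sd_map_l i h : B i h -> gr_sd_map (gr_cls S i (sdl h)) = (gr_cls B i h, 0%R).
Proof. by move=> Bh; rewrite gr_sd_mapE ?gr_cls1 //; apply: S_sdl. Qed.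

Lemma gr_sd_map_r i k : C i k -> gr_sd_map (gr_cls S i (sdr k)) = (0%R, gr_cls C i k).
Proof. by move=> Ck; rewrite gr_sd_mapE ?gr_cls1 //; apply: S_sdr. Qed.

Lemma gr_sd_map_bij i : bijective (@gr_sd_map i).
Proof.
have inj : injective (@gr_sd_map i).
  move=> z z' E; apply/eqP; rewrite -subr_eq0; apply/eqP.
  have : gr_sd_map (z - z')%R = 0%R.
    by apply: (addIr (gr_sd_map z')); rewrite -gr_sd_mapD subrK add0r.
  case: (grP (z - z')%R) => x Sx; rewrite gr_sd_mapE // => -[E1 E2].
  have [Bx Cx] := (gammap_sdprodE i x).1 Sx.
  apply: gr_cls_eq0; apply/gammap_sdprodE; split.
    rewrite -[x.1]mulg1 -invg1; apply/gr_clsP; rewrite ?gr_cls1 //; exact: np1.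
  rewrite -[x.2]mulg1 -invg1; apply/gr_clsP; rewrite ?gr_cls1 //; exact: np1.
pose psi (q : gr_sd a B C i) : gr S i :=
  gr_cls S i ((rep q.1, rep q.2) : SD).
have psiK : cancel psi (@gr_sd_map i).
  move=> [q r]; rewrite /psi gr_sd_mapE /= ?gr_repK //.
  by apply/gammap_sdprodE; split; apply: gr_rep.
by exists psi => // z; apply: inj; rewrite psiK.
Qed.

Lemma gr_actE n i j k h : n = (i + j)%N -> C j k -> B i h ->
  gr_act a n (gr_cls C j k : gr C j) (gr_cls B i h : gr B i) = gr_cls B n (a k h / h).
Proof.
case: (posnP n) => [n0 _ _ _|n0 en Ck Bh]; first exact: gr_triv.
have Ck' := @rep_cls _ (gr_pair C j) k Ck; have Bh' := @rep_cls _ (gr_pair B i) h Bh.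
have Ckr : C j (rep (gr_cls C j k)) by apply: gr_rep.
have Bhr : B i (rep (gr_cls B i h)) by apply: gr_rep.
rewrite /gr_act; move: (rep (gr_cls C j k)) (rep (gr_cls B i h)) Ckr Bhr Ck' Bh' => l t Cl Bt.
rewrite ![bot _]/= => Clk Bth.
have Bakt : B i (a k t) by apply: (aact_stable gammap_shift).
have [u Cu ->] : exists2 u, C j.+1 u & l = u * k by exists (l / k); rewrite ?mulgVK.
have -> : a (u * k) t / t = (a u (a k t) / a k t) * (a k t / t).
  by rewrite aactM; group_simp.
have B1 : B n.+1 (a u (a k t) / a k t) by rewrite en -addnS; apply: gammap_act.
have B1' : B n (a u (a k t) / a k t) by apply: (filt_desc (np_filt _)).
have Bkt : B n (a k t / t) by rewrite en; apply: gammap_act.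
rewrite gr_clsM // (gr_cls_eq0 B1) add0r.
have [v Bv ->] : exists2 v, B i.+1 v & t = v * h by exists (t / h); rewrite ?mulgVK.
have -> : a k (v * h) / (v * h) = (a k v / v) * (v * (a k h / h) * v^-1).
  by rewrite aactMr; group_simp.
have B2 : B n.+1 (a k v / v) by rewrite en -addSn; apply: gammap_act.
have Bkh : B n (a k h / h) by rewrite en; apply: gammap_act.
have B2' : B n (a k v / v) by apply: (filt_desc (np_filt _)).
by rewrite gr_clsM ?(gr_cls_eq0 B2) ?add0r ?gr_clsJ //; apply: npJ.
Qed.

(** Split both arguments into their H and K components; the bracket is
    bilinear, and the four commutators are the four terms of the semidirect
    bracket. *)
Lemma gr_sd_map_br i j (z : gr S i) (z' : gr S j) :
  gr_sd_map (lie_br z z') = lie_br (gr_sd_map z) (gr_sd_map z').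
Proof.
case: (posnP (i + j)) => [n0|n0].
  by rewrite [LHS]surjective_pairing [RHS]surjective_pairing; congr pair; apply: gr_triv.
case: (grP z) => -[h k] Sx; case: (grP z') => -[h' k'] Sy.
have [Bh Ck] : B i h /\ C i k by exact: (gammap_sdprodE i _).1 Sx.
have [Bh' Ck'] : B j h' /\ C j k' by exact: (gammap_sdprodE j _).1 Sy.
rewrite (gr_sd_mapE Sx) (gr_sd_mapE Sy).
have [Sl Sr Sl' Sr'] := And4 (S_sdl Bh) (S_sdr Ck) (S_sdl Bh') (S_sdr Ck').
have -> : gr_cls S i ((h, k) : SD) = (gr_cls S i (sdl h) + gr_cls S i (sdr k))%R.
  by rewrite -gr_clsM // -(sd_split ((h, k) : SD)).
have -> : gr_cls S j ((h', k') : SD) = (gr_cls S j (sdl h') + gr_cls S j (sdr k'))%R.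
  by rewrite -gr_clsM // -(sd_split ((h', k') : SD)).
have eN : (i + j = i + j)%N by [].
rewrite -[lie_br _ _]/(gbr (i + j) _ _) (gbrDl eN) // !(gbrDr eN) // !(gbrE eN) //.
have -> : comm (sdl h) (sdr k') = sdl ((a k' h / h)^-1).
  by rewrite sdlV -comm_sdrl; group_simp.
rewrite comm_sdl comm_sdrl comm_sdr !gr_sd_mapD.
have Bkh' : B (i + j)%N (a k h' / h') by rewrite addnC; apply: gammap_act.
have Bkh : B (i + j)%N (a k' h / h) by apply: gammap_act.
rewrite !gr_sd_map_l ?gr_sd_map_r; try by [|apply: series_comm|apply: npV].
rewrite [RHS](_ : _ = ((gbr (i + j) (gr_cls B i h) (gr_cls B j h')
    + gr_act a (i + j) (gr_cls C i k : gr C i) (gr_cls B j h' : gr B j)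
    - gr_act a (i + j) (gr_cls C j k' : gr C j) (gr_cls B i h : gr B i))%R,
  gbr (i + j) (gr_cls C i k) (gr_cls C j k'))) //.
rewrite !(gbrE eN) // (gr_actE (addnC i j)) // (gr_actE eN) // gr_clsV //.
by congr pair; rewrite /= ?addr0 ?add0r // addrAC.
Qed.

(** Both sides are expanded by Jacobson's formula from the p-th powers of the
    H and K components. *)
Lemma gr_sd_map_pow i (z : gr S i) :
  gr_sd_map (rlie_pow z) = rlie_pow (gr_sd_map z).
Proof.
case: (grP z) => -[h k] Sx; have [Bh Ck] : B i h /\ C i k by exact: (gammap_sdprodE i _).1 Sx.
have [Sl Sr] := (S_sdl Bh, S_sdr Ck).
pose u : gr S i := gr_cls S i (sdl h); pose v : gr S i := gr_cls S i (sdr k).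
have -> : gr_cls S i ((h, k) : SD) = (u + v)%R.
  by rewrite -gr_clsM // -(sd_split ((h, k) : SD)).
have uE : gr_sd_map u = (gr_cls B i h, 0%R) by apply: gr_sd_map_l.
have vE : gr_sd_map v = (0%R, gr_cls C i k) by apply: gr_sd_map_r.
have uP : gr_sd_map (rlie_pow u) = (gr_cls B (p * i) (h ^+ p), 0%R).
  by rewrite /u gr_powE // -sdlX; apply/gr_sd_map_l/np_pow.
have vP : gr_sd_map (rlie_pow v) = (0%R, gr_cls C (p * i) (k ^+ p)).
  by rewrite /v gr_powE // -sdrX; apply/gr_sd_map_r/np_pow.
have J : gr_sd_map (jacobson p u v) = jacobson p (gr_sd_map u) (gr_sd_map v).
  exact: (@morph_jacobson (gr S) (gr_sd a B C) gr_sd_map gr_sd_mapD gr_sd_map_br p i u v).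
rewrite gr_powD // !gr_sd_mapD uP vP J uE vE.
have -> : ((gr_cls B i h, 0) + (0, gr_cls C i k))%R
    = (gr_cls B i h, gr_cls C i k) :> gr_sd a B C i by congr pair; rewrite /= ?addr0 ?add0r.
rewrite [RHS](_ : _ = ((rlie_pow (gr_cls B i h : gr B i), rlie_pow (gr_cls C i k : gr C i))
    + jacobson p ((gr_cls B i h, 0%R) : gr_sd a B C i)
        ((0%R, gr_cls C i k) : gr_sd a B C i))%R); last by [].
by rewrite !gr_powE //; congr (_ + _)%R; congr pair; rewrite /= ?addr0 ?add0r.
Qed.

End Trivial.
End Semidirect3.

Local Close Scope group_scope.
Local Close Scope classical_set_scope.

Theorem theorem6p13 (p : nat) (K H : groupType) (a : autAction K H) :
  prime p ->
  [/\ forall n : nat, 0 < n ->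
        gammap p (sdprod a) n
          = sdset a (Np_closure p (gammaK a) n) (gammap p K n),
      trivial_on_modab a p -> forall n : nat, 0 < n ->
        Np_closure p (gammaK a) n = gammap p H n
    & trivial_on_modab a p ->
        compatible a (gammap p H) (gammap p K) /\
        exists phi : forall i : nat,
            gr (gammap p (sdprod a)) i ->
            gr_sd a (gammap p H) (gammap p K) i,
          is_grRLie_iso phi /\
          forall (i : nat) (x : sdprod a), gammap p (sdprod a) i x ->
            phi i (gr_cls (gammap p (sdprod a)) i x)
              = (gr_cls (gammap p H) i x.1, gr_cls (gammap p K) i x.2)].
Proof.
move=> pr; split=> [n _|tr n _|tr].
- exact: gammap_sdprod.
- exact: gammaK_closure_trivial.
split; first exact: gammap_compatible.
exists (@gr_sd_map p K H a); split; last by move=> i x; apply: gr_sd_mapE.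
split=> [i|i|i j x y|i x].
- exact: gr_sd_mapD.
- exact: gr_sd_map_bij.
- exact: gr_sd_map_br.
- exact: gr_sd_map_pow.
Qed.
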